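(* Let $(X,\mathcal{S})$ be a stratified space and let $\underline{\overline{I}}=(\overline{I},\underline{I},\mathsf{I})$ be an $\mathcal{S}$-constructible isobisheaf around $X$. Then the image $\operatorname{im}\mathsf{I}$, generated by the images of the maps $\mathsf{I}(U)$ over all $\mathcal{S}$-basic opens $U$ (with maps $\operatorname{im}\mathsf{I}(V)\to\operatorname{im}\mathsf{I}(U)$ for $V\subseteq U$ obtained by restricting $\underline{I}(V\subseteq U)$), is a colocal system under $X$; and the coimage $\operatorname{coim}\mathsf{I}$, generated by the coimages $\overline{I}(U)/\ker\mathsf{I}(U)$ over all $\mathcal{S}$-basic opens $U$ (with maps $\operatorname{coim}\mathsf{I}(U)\to\operatorname{coim}\mathsf{I}(V)$ for $V\subseteq U$ induced by $\overline{I}(V\subseteq U)$), is a local system over $X$. Furthermore, $\operatorname{im}\mathsf{I}$ is equivalent to $\operatorname{coim}\mathsf{I}$.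
   Context: **Stratified spaces.** An $n$-dimensional stratified space is a second countable, locally compact, Hausdorff space $X$ with a filtration $\emptyset=X_{-1}\subseteq\cdots\subseteq X_n=X$ such that for each $d$ and $p\in X_d-X_{d-1}$ there are a compact $(n-d-1)$-dimensional stratified space $L$ (recursive definition) and a filtration preserving homeomorphism $h:\mathbb{R}^d\times C(L)\to U$ (a local parameterization) onto an open neighborhood $U$ of $p$ with $h(0,\bullet)=p$; here $C(L)=L\times[0,\infty)/L\times\{0\}$ with cone point $\bullet$. Strata are the path components of the $X_d-X_{d-1}$; $\mathcal{S}$ is the set of strata. An $\mathcal{S}$-basic open is the image of a local parameterization; it is associated to the stratum containing $h(\mathbb{R}^d\times\bullet)$. $\mathsf{Basic}(X,\mathcal{S})$ is the poset of $\mathcal{S}$-basic opens, a basis of the topology. **Sheaves, cosheaves, bisheaves.** A sheaf (resp. cosheaf) of abelian groups on $X$ is a contravariant (resp. covariant) functor on the poset of open sets such that for every open $U$ and every open cover $\mathsf{U}$ of $U$ (a poset of open sets with union $U$ whose pairwise intersections are unions of members), $\overline{F}(U)\to\lim\overline{F}|_{\mathsf{U}}$ (resp. $\operatorname{colim}\underline{F}|_{\mathsf{U}}\to\underline{F}(U)$) is an isomorphism. It is $\mathcal{S}$-constructible if its map for $V\subseteq U$ is an isomorphism whenever $V\subseteq U$ are $\mathcal{S}$-basic opens associated to a common stratum. It is a local system (resp. colocal system) if its map is an isomorphism for every pair of $\mathcal{S}$-basic opens $V\subseteq U$. A functor on $\mathsf{Basic}(X,\mathcal{S})$ with the $\mathcal{S}$-constructibility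 property generates an $\mathcal{S}$-constructible sheaf (resp. cosheaf) by $U\mapsto\lim$ (resp. $\operatorname{colim}$) over the basic opens contained in $U$. A bisheaf around $X$ is a triple $(\overline{F},\underline{F},\mathsf{F})$ with $\overline{F}$ a sheaf, $\underline{F}$ a cosheaf and maps $\mathsf{F}(U):\overline{F}(U)\to\underline{F}(U)$ for path-connected open $U$ such that $\mathsf{F}(U)=\underline{F}(V\subseteq U)\circ\mathsf{F}(V)\circ\overline{F}(V\subseteq U)$ for all path-connected open $V\subseteq U$. It is $\mathcal{S}$-constructible if $\overline{F}$ and $\underline{F}$ are. An $\mathcal{S}$-constructible bisheaf is an isobisheaf if for all $\mathcal{S}$-basic opens $V\subseteq U$ the map $\overline{F}(V\subseteq U):\overline F(U)\to\overline F(V)$ is surjective (episheaf) and $\underline{F}(V\subseteq U):\underline F(V)\to\underline F(U)$ is injective (monocosheaf). **Equivalence of local and colocal systems.** The categories of local systems and colocal systems on $X$ are equivalent: a local system $\overline{F}$ corresponds to the colocal system generated by $U\mapsto\overline{F}(U)$ on basic opens with maps $\overline{F}(V\subseteq U)^{-1}$, and conversely. A colocal system is called equivalent to a local system if they correspond, up to isomorphism, under this equivalence. *)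

(* Defs.v *)
From HB Require Import structures.
From mathcomp Require Import all_boot all_order all_algebra.
From mathcomp Require Import all_classical all_reals topology normedtype.
Set Implicit Arguments.
Unset Strict Implicit.
Unset Printing Implicit Defensive.
Import Order.TTheory GRing.Theory Num.Theory.
Import numFieldNormedType.Exports.
Local Open Scope classical_set_scope.
Local Open Scope quotient_scope.
Local Open Scope ring_scope.

Definition mk_additive (A B : zmodType) (f : A -> B) (fB : zmod_morphism f) :
    {additive A -> B} :=
  HB.pack_for {additive A -> B} f (GRing.isZmodMorphism.Build A B f fB).

Section Image.
Variables (A B : zmodType) (f : {additive A -> B}).

Definition in_im (y : B) : bool := `[< exists x, f x = y >].

Fact in_im_zmod_closed : zmod_closed in_im.
Proof.
split=> [|y1 y2 /asboolP[x1 <-] /asboolP[x2 <-]]; apply/asboolP.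
- by exists 0; rewrite raddf0.
- by exists (x1 - x2); rewrite raddfB.
Qed.
HB.instance Definition _ := GRing.isZmodClosed.Build B in_im in_im_zmod_closed.

Definition im : Type := {y : B | in_im y}.
HB.instance Definition _ := SubType.on im.
HB.instance Definition _ := [Choice of im by <:].
HB.instance Definition _ := [SubChoice_isSubZmodule of im by <:].
End Image.

Section ImageMap.
Variables (A B A' B' : zmodType) (f : {additive A -> B}).
Variables (f' : {additive A' -> B'}) (g : {additive B -> B'}).
Hypothesis gP : forall y, in_im f y -> in_im f' (g y).

Definition im_restr_fun (y : im f) : im f' := Sub (g (val y)) (gP (valP y)).
Fact im_restr_additive : zmod_morphism im_restr_fun.
Proof. by move=> x y; apply: val_inj; rewrite /= !raddfB. Qed.
Definition im_restr := mk_additive im_restr_additive.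
End ImageMap.

Section Coimage.
Variables (A B : zmodType) (f : {additive A -> B}).

Definition ker_rel : rel A := [rel x y | f (x - y) == 0].

Lemma ker_relE x y : ker_rel x y = (f x == f y).
Proof. by rewrite /ker_rel /= raddfB subr_eq0. Qed.
Fact ker_rel_refl : reflexive ker_rel.
Proof. by move=> x; rewrite ker_relE. Qed.
Fact ker_rel_sym : symmetric ker_rel.
Proof. by move=> x y; rewrite !ker_relE eq_sym. Qed.
Fact ker_rel_trans : transitive ker_rel.
Proof. by move=> y x z; rewrite !ker_relE => /eqP->. Qed.

Canonical ker_equiv := EquivRel ker_rel ker_rel_refl ker_rel_sym ker_rel_trans.

Definition coim : Type := {eq_quot ker_equiv}.
HB.instance Definition _ := EqQuotient.on coim.
HB.instance Definition _ := Choice.on coim.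

Lemma coim_eqP x y : reflect (f x = f y) (\pi_coim x == \pi_coim y).
Proof. by rewrite eqmodE /= ker_relE; exact: eqP. Qed.

Lemma coim_eq x y : f x = f y -> \pi_coim x = \pi_coim y.
Proof. by move=> /coim_eqP /eqP. Qed.

Lemma coim_reprK x : f (repr (\pi_coim x)) = f x.
Proof. by apply/coim_eqP; rewrite reprK. Qed.

Definition coim_add (x y : coim) : coim := \pi_coim (repr x + repr y).
Definition coim_opp (x : coim) : coim := \pi_coim (- repr x).

Fact coim_addA : associative coim_add.
Proof.
elim/quotW=> x; elim/quotW=> y; elim/quotW=> z.
by apply: coim_eq; rewrite !(raddfD, coim_reprK) addrA.
Qed.
Fact coim_addC : commutative coim_add.
Proof. by move=> x y; rewrite /coim_add addrC. Qed.
Fact coim_add0 : left_id (\pi_coim 0) coim_add.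
Proof.
by elim/quotW=> x; apply: coim_eq; rewrite !(raddfD, coim_reprK, raddf0) add0r.
Qed.
Fact coim_addN : left_inverse (\pi_coim 0) coim_opp coim_add.
Proof.
elim/quotW=> x; apply: coim_eq.
by rewrite !(raddfD, coim_reprK, raddfN, raddf0) addNr.
Qed.
HB.instance Definition _ :=
  GRing.isZmodule.Build coim coim_addA coim_addC coim_add0 coim_addN.

Lemma coim_piD x y : \pi_coim (x + y) = \pi_coim x + \pi_coim y.
Proof. by apply: coim_eq; rewrite !(raddfD, coim_reprK). Qed.
Lemma coim_piN x : \pi_coim (- x) = - \pi_coim x.
Proof. by apply: coim_eq; rewrite !(raddfN, coim_reprK). Qed.
End Coimage.

Section CoimageMap.
Variables (A B A' B' : zmodType) (f : {additive A -> B}).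
Variables (f' : {additive A' -> B'}) (g : {additive A -> A'}).
Hypothesis gP : forall x, f x = 0 -> f' (g x) = 0.

Definition coim_ind_fun (x : coim f) : coim f' := \pi_(coim f') (g (repr x)).

Lemma coim_ind_funE x : coim_ind_fun (\pi_(coim f) x) = \pi_(coim f') (g x).
Proof.
apply: coim_eq; apply/eqP; rewrite -subr_eq0 -!raddfB; apply/eqP/gP.
by rewrite raddfB coim_reprK subrr.
Qed.
Fact coim_ind_additive : zmod_morphism coim_ind_fun.
Proof.
elim/quotW=> x; elim/quotW=> y.
by rewrite -coim_piN -coim_piD !coim_ind_funE raddfB coim_piD coim_piN.
Qed.
Definition coim_ind := mk_additive coim_ind_additive.
End CoimageMap.

Section Inverse.
Variables (A B : zmodType) (f : {additive A -> B}).

Lemma bij_inv_ex : bijective f -> {g : B -> A | cancel f g /\ cancel g f}.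
Proof. by move=> fbij; apply: cid; case: fbij => g; exists g. Qed.

Definition bij_inv_fun (fbij : bijective f) : B -> A := sval (bij_inv_ex fbij).

Fact bij_inv_additive (fbij : bijective f) : zmod_morphism (bij_inv_fun fbij).
Proof.
have [fK gK] := svalP (bij_inv_ex fbij).
by move=> x y; apply: (canLR fK); rewrite raddfB !gK.
Qed.

Definition bij_inv (fbij : bijective f) : {additive B -> A} :=
  mk_additive (bij_inv_additive fbij).

Lemma bij_invK fbij : cancel f (bij_inv fbij).
Proof. by have [] := svalP (bij_inv_ex fbij). Qed.
Lemma bij_invKV fbij : cancel (bij_inv fbij) f.
Proof. by have [] := svalP (bij_inv_ex fbij). Qed.
End Inverse.

(* A functor from the preorder [(I, le)] to abelian groups.  It is contravariant
   on a poset of sets when [le] is reverse inclusion.  [le] is only ever used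
   at reflexive and transitive relations. *)
Record functor (I : Type) (le : I -> I -> Prop) := Functor {
  fun_obj :> I -> zmodType;
  fun_map : forall i j, le i j -> {additive fun_obj i -> fun_obj j};
  fun_map_id : forall i (h : le i i) x, fun_map h x = x;
  fun_map_comp : forall i j k (hij : le i j) (hjk : le j k) (hik : le i k) x,
    fun_map hik x = fun_map hjk (fun_map hij x) }.
Arguments fun_map {I le} f [i j].

Definition reindex (J I : Type) (le : I -> I -> Prop) (f : J -> I)
    (D : functor le) : functor (fun j j' => le (f j) (f j')) :=
  @Functor J (fun j j' => le (f j) (f j')) (fun j => D (f j))
    (fun j j' h => fun_map D h) (fun j h => @fun_map_id I le D (f j) h)
    (fun i j k => @fun_map_comp I le D (f i) (f j) (f k)).

Definition functor_iso (I : Type) (le : I -> I -> Prop) (D E : functor le) :=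
  exists phi : forall i, {additive D i -> E i},
    (forall i, bijective (phi i)) /\
    (forall i j (h : le i j) x, phi j (fun_map D h x) = fun_map E h (phi i x)).

Section Limit.
Variables (I : Type) (le : I -> I -> Prop) (D : functor le).

Definition compatible (x : forall i, D i) :=
  forall i j (h : le i j), fun_map D h (x i) = x j.

Record lim : Type := Lim { lim_val :> forall i, D i; _ : compatible lim_val }.

Lemma limP (x : lim) : compatible x. Proof. by case: x. Qed.
Lemma lim_eqP (x y : lim) : (forall i, x i = y i) -> x = y.
Proof.
case: x y => [x xP] [y yP] /= xy.
have {}xy : x = y by apply: functional_extensionality_dep.
by subst y; congr Lim; exact: Prop_irrelevance.
Qed.
HB.instance Definition _ := gen_eqMixin lim.
HB.instance Definition _ := gen_choiceMixin lim.

Fact lim0_subproof : compatible (fun=> 0).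
Proof. by move=> i j h; rewrite raddf0. Qed.
Fact limD_subproof (x y : lim) : compatible (fun i => x i + y i).
Proof. by move=> i j h; rewrite raddfD !limP. Qed.
Fact limN_subproof (x : lim) : compatible (fun i => - x i).
Proof. by move=> i j h; rewrite raddfN limP. Qed.

Fact lim_addA : associative (fun x y => Lim (limD_subproof x y)).
Proof. by move=> x y z; apply: lim_eqP => i; rewrite /= addrA. Qed.
Fact lim_addC : commutative (fun x y => Lim (limD_subproof x y)).
Proof. by move=> x y; apply: lim_eqP => i; rewrite /= addrC. Qed.
Fact lim_add0 : left_id (Lim lim0_subproof) (fun x y => Lim (limD_subproof x y)).
Proof. by move=> x; apply: lim_eqP => i; rewrite /= add0r. Qed.
Fact lim_addN : left_inverse (Lim lim0_subproof)
  (fun x => Lim (limN_subproof x)) (fun x y => Lim (limD_subproof x y)).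
Proof. by move=> x; apply: lim_eqP => i; rewrite /= addNr. Qed.
HB.instance Definition _ :=
  GRing.isZmodule.Build lim lim_addA lim_addC lim_add0 lim_addN.

Definition is_cone (A : zmodType) (p : forall i, {additive A -> D i}) :=
  forall i j (h : le i j) a, fun_map D h (p i a) = p j a.

Fact lim_proj_additive i : zmod_morphism (fun x : lim => x i).
Proof. by []. Qed.
Definition lim_proj i : {additive lim -> D i} :=
  mk_additive (lim_proj_additive i).

Section Lift.
Variables (A : zmodType) (p : forall i, {additive A -> D i}) (pP : is_cone p).

Fact lim_lift_subproof a : compatible (fun i => p i a).
Proof. by move=> i j h; exact: pP. Qed.
Fact lim_lift_additive : zmod_morphism (fun a => Lim (lim_lift_subproof a)).
Proof. by move=> a b; apply: lim_eqP => i; rewrite /= raddfB. Qed.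
Definition lim_lift : {additive A -> lim} := mk_additive lim_lift_additive.
End Lift.

End Limit.
Arguments is_cone {I le} D {A} p.
Arguments lim_proj {I le} D i.

Section Colimit.
Variables (I : Type) (le : I -> I -> Prop) (D : functor le).

Definition is_cocone (A : zmodType) (q : forall i, {additive D i -> A}) :=
  forall i j (h : le i j) x, q j (fun_map D h x) = q i x.

Definition fsum : Type := seq {i : I & D i}.
HB.instance Definition _ := gen_eqMixin fsum.
HB.instance Definition _ := gen_choiceMixin fsum.

Definition fsum_eval (A : zmodType) (q : forall i, {additive D i -> A})
  (s : fsum) : A := \sum_(u <- s) q (tag u) (tagged u).

(* The colimit consists of formal sums of elements of the groups [D i], two of
   them being identified when no cocone separates them; [colim_descE] and
   [colim_desc_unique] give its universal property. *)
Definition colim_rel : rel fsum := [rel s t |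
  `[< forall (A : zmodType) (q : forall i, {additive D i -> A}),
        is_cocone q -> fsum_eval q s = fsum_eval q t >] ].

Fact colim_rel_refl : reflexive colim_rel.
Proof. by move=> s; apply/asboolP. Qed.
Fact colim_rel_sym : symmetric colim_rel.
Proof.
by move=> s t; apply/asboolP/asboolP => st A q qP; apply/esym/st.
Qed.
Fact colim_rel_trans : transitive colim_rel.
Proof.
move=> t s u /asboolP st /asboolP tu; apply/asboolP => A q qP.
by rewrite st // tu.
Qed.
Canonical colim_equiv :=
  EquivRel colim_rel colim_rel_refl colim_rel_sym colim_rel_trans.

Definition colim : Type := {eq_quot colim_equiv}.
HB.instance Definition _ := EqQuotient.on colim.
HB.instance Definition _ := Choice.on colim.

Lemma colim_eqP (s t : fsum) :
  (forall (A : zmodType) (q : forall i, {additive D i -> A}),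
     is_cocone q -> fsum_eval q s = fsum_eval q t) <->
  \pi_colim s = \pi_colim t.
Proof. by split=> [st|/eqmodP/asboolP//]; apply/eqmodP/asboolP. Qed.

Lemma colim_reprK (A : zmodType) (q : forall i, {additive D i -> A}) s :
  is_cocone q -> fsum_eval q (repr (\pi_colim s)) = fsum_eval q s.
Proof. by apply: (colim_eqP _ _).2; rewrite reprK. Qed.

Definition fsum_opp (s : fsum) : fsum :=
  [seq existT (fun i => D i : Type) (tag u) (- tagged u) | u : {i : I & D i} <- s].

Lemma fsum_evalD A q s t : @fsum_eval A q (s ++ t) = fsum_eval q s + fsum_eval q t.
Proof. exact: big_cat. Qed.
Lemma fsum_evalN A q s : @fsum_eval A q (fsum_opp s) = - fsum_eval q s.
Proof.
rewrite /fsum_eval big_map -sumrN; apply: eq_bigr => u _ /=.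
by rewrite raddfN.
Qed.
Lemma fsum_eval0 A q : @fsum_eval A q [::] = 0.
Proof. exact: big_nil. Qed.

Definition colim_add (x y : colim) : colim := \pi_colim (repr x ++ repr y).
Definition colim_opp (x : colim) : colim := \pi_colim (fsum_opp (repr x)).

Fact colim_addA : associative colim_add.
Proof.
elim/quotW=> x; elim/quotW=> y; elim/quotW=> z.
by apply/colim_eqP => A q qP; rewrite !(fsum_evalD, colim_reprK) // addrA.
Qed.
Fact colim_addC : commutative colim_add.
Proof.
move=> x y; apply/colim_eqP => A q qP.
by rewrite !fsum_evalD addrC.
Qed.
Fact colim_add0 : left_id (\pi_colim [::]) colim_add.
Proof.
elim/quotW=> x; apply/colim_eqP => A q qP.
by rewrite !(fsum_evalD, colim_reprK) // fsum_eval0 add0r.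
Qed.
Fact colim_addN : left_inverse (\pi_colim [::]) colim_opp colim_add.
Proof.
elim/quotW=> x; apply/colim_eqP => A q qP.
by rewrite !(fsum_evalD, colim_reprK, fsum_evalN, fsum_eval0) // addNr.
Qed.
HB.instance Definition _ :=
  GRing.isZmodule.Build colim colim_addA colim_addC colim_add0 colim_addN.

Lemma colim_piD s t : \pi_colim (s ++ t) = \pi_colim s + \pi_colim t.
Proof.
by apply/colim_eqP => A q qP; rewrite !(fsum_evalD, colim_reprK).
Qed.
Lemma colim_piN s : \pi_colim (fsum_opp s) = - \pi_colim s.
Proof.
by apply/colim_eqP => A q qP; rewrite !(fsum_evalN, colim_reprK).
Qed.

Definition colim_in_fun i (x : D i) : colim :=
  \pi_colim [:: existT (fun i => D i : Type) i x].
Fact colim_in_additive i : zmod_morphism (@colim_in_fun i).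
Proof.
move=> x y; rewrite /colim_in_fun -colim_piN -colim_piD.
by apply/colim_eqP => A q qP; rewrite fsum_evalD fsum_evalN /fsum_eval !big_seq1 raddfB.
Qed.
Definition colim_in i : {additive D i -> colim} :=
  mk_additive (@colim_in_additive i).

Lemma colim_in_cocone : is_cocone colim_in.
Proof.
move=> i j h x; apply/colim_eqP => A q qP.
by rewrite /fsum_eval !big_seq1 /= qP.
Qed.

Section Desc.
Variables (A : zmodType) (q : forall i, {additive D i -> A}) (qP : is_cocone q).

Fact colim_desc_additive : zmod_morphism (fun x : colim => fsum_eval q (repr x)).
Proof.
elim/quotW=> x; elim/quotW=> y.
by rewrite -colim_piN -colim_piD !colim_reprK // fsum_evalD fsum_evalN.
Qed.
Definition colim_desc : {additive colim -> A} := mk_additive colim_desc_additive.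

Lemma colim_descE i x : colim_desc (colim_in i x) = q i x.
Proof. by rewrite [LHS]colim_reprK // /fsum_eval big_seq1. Qed.

Lemma colim_desc_unique (g : {additive colim -> A}) :
  (forall i x, g (colim_in i x) = q i x) -> g =1 colim_desc.
Proof.
move=> gE; elim/quotW => s; rewrite /= colim_reprK //.
elim: s => [|[i x] s IHs].
  by rewrite fsum_eval0; exact: raddf0.
by rewrite -cat1s colim_piD raddfD IHs fsum_evalD /fsum_eval big_seq1 -gE.
Qed.
End Desc.

Lemma colim_ext (A : zmodType) (g g' : {additive colim -> A}) :
  (forall i x, g (colim_in i x) = g' (colim_in i x)) -> g =1 g'.
Proof.
move=> gg' x.
have qP : is_cocone (fun i => [the {additive D i -> A} of g \o colim_in i]).
  by move=> i j h y; congr (g _); exact: colim_in_cocone.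
rewrite (colim_desc_unique qP (g := g)) //; apply/esym.
by apply: colim_desc_unique => i y; rewrite -gg'.
Qed.

End Colimit.
Arguments is_cocone {I le} D {A} q.
Arguments colim_in {I le} D i.

Section Cone.
Variables (R : realType) (L : topologicalType).

(* The quotient L x [0, oo) / L x {0}: [Some (x, t)] is the class of (x, t) for
   t > 0, [None] is the cone point, and [cone_proj] is the quotient map, which
   defines the topology.  By convention the cone on the empty space is the cone
   point, as needed at the points of X_n - X_(n-1), where L is empty. *)
Definition cone : Type := option (L * {t : R | 0 < t}).
HB.instance Definition _ := Choice.on cone.

Definition cone_proj (y : L * set_type (`[0, +oo[ : set R)) : cone :=
  omap (pair y.1) (insub (val y.2)).

Definition cone_open (A : set cone) : Prop := open (cone_proj @^-1` A).

Fact cone_openT : cone_open setT.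
Proof. by rewrite /cone_open preimage_setT; exact: openT. Qed.
Fact cone_openI : setI_closed cone_open.
Proof. by move=> A B oA oB; rewrite /cone_open preimage_setI; exact: openI. Qed.
Fact cone_open_bigU (I : Type) (f : I -> set cone) :
  (forall i, cone_open (f i)) -> cone_open (\bigcup_i f i).
Proof.
by move=> fo; rewrite /cone_open preimage_bigcup; apply: bigcup_open => i _; exact: fo.
Qed.
HB.instance Definition _ :=
  isOpenTopological.Build cone cone_openT cone_openI cone_open_bigU.

Lemma cone_proj_continuous : continuous cone_proj.
Proof. exact/continuousP. Qed.

Definition cone_pt : cone := None.

(* C(A) as a subset of C(L); it is the cone point when A is empty. *)
Definition subcone (A : set L) : set cone :=
  [set c | if c is Some (x, _) then A x else True].

End Cone.
Arguments cone_pt {R L}.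

(* In a filtration F, [F i] is meaningful for -1 <= i <= n only. *)
Definition filtration (n : int) (X : Type) (F : int -> set X) : Prop :=
  [/\ F (-1) = set0, F n = setT &
      forall i j : int, -1 <= i -> i <= j -> j <= n -> F i `<=` F j].

(* The product filtration on R^d x C(L): its i-th term is R^d x C(L_(i-d-1)) for
   i >= d and is empty for i < d. *)
Definition prod_cone_filtration (R : realType) (d : nat) (L : topologicalType)
    (G : int -> set L) (i : int) : set ('rV[R]_d * cone R L) :=
  [set z | d%:Z <= i /\ subcone (G (i - d%:Z - 1)) z.2].

Definition open_embedding (Y X : topologicalType) (h : Y -> X) : Prop :=
  [/\ continuous h, open (range h) &
      exists2 g : X -> Y, cancel h g & {within range h, continuous g}].

(* h is a filtration preserving homeomorphism from R^d x C(L) onto an open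
   neighborhood of p in X_d - X_(d-1), with h(0, cone point) = p. *)
Definition local_param (R : realType) (n : int) (X : topologicalType)
    (F : int -> set X) (d : nat) (p : X) (L : topologicalType)
    (G : int -> set L) (h : 'rV[R]_d * cone R L -> X) : Prop :=
  [/\ (F d%:Z `\` F (d%:Z - 1)) p,
      open_embedding h,
      forall i : int, -1 <= i -> i <= n ->
        h @` prod_cone_filtration G i = F i `&` range h &
      h (0, cone_pt) = p].

Inductive stratified (R : realType) (n : int) (X : topologicalType)
    (F : int -> set X) : Prop :=
  Stratified of -1 <= n & @second_countable X & locally_compact [set: X]
    & hausdorff_space X & filtration n F
    & (forall (d : nat) (p : X), d%:Z <= n -> (F d%:Z `\` F (d%:Z - 1)) p ->
        exists (L : topologicalType) (G : int -> set L)
               (h : 'rV[R]_d * cone R L -> X),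
          [/\ compact [set: L], stratified R (n - d%:Z - 1) G &
              local_param n F p G h]).

Record stratSpace (R : realType) := StratSpace {
  strat_space :> topologicalType;
  dim : int;
  skeleton : int -> set strat_space;
  stratSpaceP : stratified R dim skeleton }.

Arguments dim {R} s.
Arguments skeleton {R} s i.

(* A path is a map on R whose restriction to [0, 1] is continuous. *)
Definition path_in (R : realType) (X : topologicalType) (A : set X) (x y : X) :=
  exists gamma : R -> X,
    [/\ {within `[0, 1], continuous gamma}, gamma 0 = x, gamma 1 = y &
        forall t, 0 <= t <= 1 -> A (gamma t)].

(* The empty set is excluded: as sheaves vanish on it, the naturality of a
   bisheaf with V empty would otherwise force all its maps to be zero. *)
Definition path_connected (R : realType) (X : topologicalType) (A : set X) :=
  A !=set0 /\ forall x y, A x -> A y -> path_in R A x y.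

Section Basic.
Variables (R : realType) (X : stratSpace R).

Definition pure_part (d : nat) : set X :=
  skeleton X d%:Z `\` skeleton X (d%:Z - 1).

Definition strata : set (set X) :=
  [set S | exists (d : nat) (p : X), [/\ d%:Z <= dim X, pure_part d p &
     S = [set q | path_in R (pure_part d) p q]]].

Definition param_of (U : set X) (d : nat) (p : X) (L : topologicalType)
    (G : int -> set L) (h : 'rV[R]_d * cone R L -> X) : Prop :=
  [/\ d%:Z <= dim X, compact [set: L], stratified R (dim X - d%:Z - 1) G,
      local_param (dim X) (skeleton X) p G h & U = range h].

Definition basic : set (set X) :=
  [set U | exists (d : nat) (p : X) (L : topologicalType) (G : int -> set L)
             (h : 'rV[R]_d * cone R L -> X), param_of U p G h].

Definition associated (U S : set X) : Prop :=
  strata S /\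
  exists (d : nat) (p : X) (L : topologicalType) (G : int -> set L)
         (h : 'rV[R]_d * cone R L -> X),
    param_of U p G h /\ forall v, S (h (v, cone_pt)).

Lemma basic_open U : basic U -> open U.
Proof. by move=> [d [p [L [G [h [_ _ _ [_ [_ oh _] _ _] ->]]]]]]. Qed.

End Basic.

Section ConePath.
Variables (R : realType) (L : topologicalType).

Fact cone_scale_subproof (s : R) (t : {t : R | 0 < t}) :
  `|s| * val t \in (`[0, +oo[%classic : set R).
Proof. by rewrite inE /= in_itv /= andbT mulr_ge0 // ltW // (valP t). Qed.

Definition cone_scale (s : R) (c : cone R L) : cone R L :=
  if c is Some (x, t) then cone_proj (x, SigSub (cone_scale_subproof s t))
  else None.

Lemma cone_scale1 c : cone_scale 1 c = c.
Proof.
case: c => [[x t]|] //=; rewrite /cone_proj /= normr1 mul1r.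
by rewrite valK.
Qed.

Lemma cone_scale0 c : cone_scale 0 c = cone_pt.
Proof.
case: c => [[x t]|] //=; rewrite /cone_proj /= normr0 mul0r.
by rewrite insubN ?ltxx.
Qed.

Lemma cone_scale_continuous c : continuous (cone_scale^~ c).
Proof.
case: c => [[x t]|] s; last exact: cst_continuous.
pose k (s : R) : L * set_type (`[0, +oo[ : set R) :=
  (x, SigSub (cone_scale_subproof s t)).
rewrite -/(@cone_proj R L \o k).
apply: (@continuous_comp _ _ _ k (@cone_proj R L)); last first.
  exact: cone_proj_continuous.
have c2 : continuous (fun r => (k r).2).
  apply: (@continuous_comp_initial _ _ _ set_val) => r /=.
  by apply: cvgMl; exact: norm_continuous.
exact: (cvg_pair (cvg_cst _) (c2 s)).
Qed.

Lemma cylinder_path_connected (X : topologicalType) (d : nat)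
  (h : 'rV[R]_d * cone R L -> X) : continuous h -> path_connected R (range h).
Proof.
move=> hc; split; first by exists (h (0, cone_pt)); exists (0, cone_pt).
move=> _ _ [[v1 c1] _ <-] [[v2 c2] _ <-].
pose k (v : 'rV[R]_d) c (s : R) : 'rV[R]_d * cone R L :=
  (s *: v, cone_scale s c).
have kc v c : continuous (k v c).
  move=> s.
  exact: (cvg_pair (@scalel_continuous R 'rV[R]_d v s) (@cone_scale_continuous c s)).
pose f v c := h \o k v c.
have fc v c (g : R -> R) : continuous g -> continuous (f v c \o g).
  move=> gc t; apply: continuous_comp; first exact: gc.
  by apply: continuous_comp; [exact: kc | exact: hc].
pose g1 (t : R) := 1 - 2 * t; pose g2 (t : R) := 2 * t - 1.
have g1c : continuous g1.
  by move=> t; apply: cvgB; [exact: cvg_cst | apply: cvgMr; exact: cvg_id].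
have g2c : continuous g2.
  by move=> t; apply: cvgB; [apply: cvgMr; exact: cvg_id | exact: cvg_cst].
exists (fun t => if t <= 2^-1 then (f v1 c1 \o g1) t else (f v2 c2 \o g2) t).
split.
- pose B : set R := `]-oo, 2^-1] `|` `[2^-1, +oo[.
  apply: (@continuous_subspaceW _ _ _ B).
    move=> t _; case: (leP t 2^-1) => t2; [left | right];
      by rewrite /= in_itv /= ?andbT // ltW.
  apply: withinU_continuous; [exact: lray_closed | exact: rray_closed | |].
    apply: (@subspace_eq_continuous _ _ _ (f v1 c1 \o g1)).
      by move=> t; rewrite inE /= in_itv /= => t2; rewrite /from_subspace /= t2.
    by apply: continuous_subspaceT; exact: fc.
  apply: (@subspace_eq_continuous _ _ _ (f v2 c2 \o g2)).
    move=> t; rewrite inE /= in_itv /= andbT => t2; rewrite /from_subspace /=.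
    case: ifPn => // t2'.
    have -> : t = 2^-1 by apply/eqP; rewrite eq_le t2 t2'.
    by rewrite /f /k /g1 /g2 /= divff ?pnatr_eq0 // subrr !scale0r !cone_scale0.
  by apply: continuous_subspaceT; exact: fc.
- by rewrite invr_ge0 ler0n /f /k /g1 /= mulr0 subr0 scale1r cone_scale1.
- rewrite ifN; last by rewrite -ltNge invf_lt1 ?ltr0n // ltr1n.
  by rewrite /f /k /g2 /= mulr1 -[X in X - 1]/(1 + 1) addrK scale1r cone_scale1.
- by move=> t _; case: ifP => _; eexists.
Qed.

End ConePath.

Lemma basic_path_connected (R : realType) (X : stratSpace R) (U : set X) :
  basic U -> path_connected R U.
Proof.
move=> [d [p [L [G [h [_ _ _ [_ [hc _ _] _ _] ->]]]]]].
exact: cylinder_path_connected.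
Qed.

Section Poset.
Variables (X : Type) (P : set (set X)).

Definition incl (V U : set_type P) : Prop := val V `<=` val U.
Definition rincl (U V : set_type P) : Prop := val V `<=` val U.
End Poset.

Section Sheaves.
Variable X : topologicalType.

Definition opens : Type := set_type (@open X).
Definition presheaf : Type := functor (@rincl X open).
Definition copresheaf : Type := functor (@incl X open).

Definition to_open (P : set (set X)) (Po : P `<=` open) (V : set_type P) : opens :=
  SigSub (mem_set (Po _ (set_valP V))).

Definition is_cover (U : set X) (C : set (set X)) : Prop :=
  [/\ C `<=` open, \bigcup_(V in C) V = U &
      forall V W, C V -> C W ->
        exists2 D : set (set X), D `<=` C & V `&` W = \bigcup_(Z in D) Z].

Lemma is_cover_open U C : is_cover U C -> C `<=` open. Proof. by case. Qed.

Section Cover.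
Variables (U : opens) (C : set (set X)) (UC : is_cover (val U) C).

Definition member (V : set_type C) : opens := to_open (is_cover_open UC) V.

Lemma member_sub V : val (member V) `<=` val U.
Proof. by case: UC => _ <- _ x Vx; exists (val V) => //; exact: set_valP. Qed.

Section Sheaf.
Variable F : presheaf.
Let res V : {additive F U -> F (member V)} := fun_map F (@member_sub V).
Fact cover_cone : is_cone (reindex member F) res.
Proof. by move=> V W h x; apply/esym; exact: (@fun_map_comp _ _ F). Qed.
Definition to_cover_lim : {additive F U -> lim (reindex member F)} :=
  lim_lift cover_cone.
End Sheaf.

Section Cosheaf.
Variable F : copresheaf.
Let ext V : {additive F (member V) -> F U} := fun_map F (@member_sub V).
Fact cover_cocone : is_cocone (reindex member F) ext.
Proof. by move=> V W h x; apply/esym; exact: (@fun_map_comp _ _ F). Qed.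
Definition of_cover_colim : {additive colim (reindex member F) -> F U} :=
  colim_desc cover_cocone.
End Cosheaf.
End Cover.

Definition is_sheaf (F : presheaf) : Prop :=
  forall (U : opens) (C : set (set X)) (UC : is_cover (val U) C),
    bijective (to_cover_lim UC F).

Definition is_cosheaf (F : copresheaf) : Prop :=
  forall (U : opens) (C : set (set X)) (UC : is_cover (val U) C),
    bijective (of_cover_colim UC F).

End Sheaves.

Section Constructible.
Variables (R : realType) (X : stratSpace R).

Definition basics : Type := set_type (@basic R X).
Definition basic_to_open : basics -> opens X := to_open (@basic_open R X).

Definition sheaf_constructible (F : presheaf X) : Prop :=
  forall (V U : basics) (VU : val V `<=` val U) (S : set X),
    associated (val V) S -> associated (val U) S ->
    bijective (fun_map F (VU : rincl (basic_to_open U) (basic_to_open V))).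

Definition cosheaf_constructible (F : copresheaf X) : Prop :=
  forall (V U : basics) (VU : val V `<=` val U) (S : set X),
    associated (val V) S -> associated (val U) S ->
    bijective (fun_map F (VU : incl (basic_to_open V) (basic_to_open U))).

Definition is_local_system (F : presheaf X) : Prop :=
  is_sheaf F /\ forall (V U : basics) (VU : val V `<=` val U),
    bijective (fun_map F (VU : rincl (basic_to_open U) (basic_to_open V))).

Definition is_colocal_system (F : copresheaf X) : Prop :=
  is_cosheaf F /\ forall (V U : basics) (VU : val V `<=` val U),
    bijective (fun_map F (VU : incl (basic_to_open V) (basic_to_open U))).

Definition basics_in (U : opens X) : Type := {B : basics | val B `<=` val U}.
Definition basics_in_val (U : opens X) (B : basics_in U) : basics := sval B.
Definition basics_in_widen (V U : opens X) (VU : val V `<=` val U)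
    (B : basics_in V) : basics_in U :=
  exist _ (sval B) (subset_trans (svalP B) VU).

Section GenSheaf.
Variable G : functor (@rincl X (@basic R X)).

Let lim_in U := lim (reindex (@basics_in_val U) G).

Section Restriction.
Variables (U V : opens X) (VU : rincl U V).
Let p (B : basics_in V) : {additive lim_in U -> reindex (@basics_in_val V) G B} :=
  lim_proj (reindex (@basics_in_val U) G) (basics_in_widen VU B).
Fact gen_sheaf_cone : is_cone (reindex (@basics_in_val V) G) p.
Proof.
by move=> B B' h x; exact: (@limP _ _ _ x (basics_in_widen VU B)
                                          (basics_in_widen VU B') h).
Qed.
Definition gen_sheaf_map : {additive lim_in U -> lim_in V} :=
  lim_lift gen_sheaf_cone.
End Restriction.

Fact gen_sheaf_map_id U (UU : rincl U U) x : gen_sheaf_map UU x = x.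
Proof.
apply: lim_eqP => -[B BU]; rewrite /= /basics_in_widen /=.
by rewrite (Prop_irrelevance (subset_trans _ UU) BU).
Qed.

Fact gen_sheaf_map_comp U V W (UV : rincl U V) (VW : rincl V W)
  (UW : rincl U W) x : gen_sheaf_map UW x = gen_sheaf_map VW (gen_sheaf_map UV x).
Proof.
apply: lim_eqP => -[B BW]; rewrite /= /basics_in_widen /=.
by congr (lim_val x (exist _ B _)); exact: Prop_irrelevance.
Qed.

Definition gen_sheaf : presheaf X :=
  Functor gen_sheaf_map_id gen_sheaf_map_comp.
End GenSheaf.

Section GenCosheaf.
Variable G : functor (@incl X (@basic R X)).

Let colim_on U := colim (reindex (@basics_in_val U) G).

Section Extension.
Variables (V U : opens X) (VU : incl V U).
Let q (B : basics_in V) : {additive reindex (@basics_in_val V) G B -> colim_on U} :=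
  colim_in (reindex (@basics_in_val U) G) (basics_in_widen VU B).
Fact gen_cosheaf_cocone : is_cocone (reindex (@basics_in_val V) G) q.
Proof.
by move=> B B' h x;
   exact: (@colim_in_cocone _ _ (reindex (@basics_in_val U) G)
             (basics_in_widen VU B) (basics_in_widen VU B') h).
Qed.
Definition gen_cosheaf_map : {additive colim_on V -> colim_on U} :=
  colim_desc gen_cosheaf_cocone.
End Extension.

Fact gen_cosheaf_map_id U (UU : incl U U) x : gen_cosheaf_map UU x = x.
Proof.
apply: (@colim_ext _ _ _ _ (gen_cosheaf_map UU) idfun) => B y.
rewrite colim_descE /=.
case: B y => B BU y; rewrite /basics_in_widen /=.
by rewrite (Prop_irrelevance (subset_trans _ UU) BU).
Qed.

Fact gen_cosheaf_map_comp U V W (UV : incl U V) (VW : incl V W)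
  (UW : incl U W) x :
  gen_cosheaf_map UW x = gen_cosheaf_map VW (gen_cosheaf_map UV x).
Proof.
apply: (@colim_ext _ _ _ _ (gen_cosheaf_map UW)
         (gen_cosheaf_map VW \o gen_cosheaf_map UV)) => B y.
transitivity (gen_cosheaf_map VW (gen_cosheaf_map UV (colim_in _ B y))); last by [].
rewrite !colim_descE.
by congr (colim_in (reindex (@basics_in_val W) G) (exist _ (sval B) _) y);
  exact: Prop_irrelevance.
Qed.

Definition gen_cosheaf : copresheaf X :=
  Functor gen_cosheaf_map_id gen_cosheaf_map_comp.
End GenCosheaf.

Section Correspondence.
Variables (F : presheaf X) (Floc : is_local_system F).

Definition inverse_map (V U : basics) (VU : incl V U) :
    {additive F (basic_to_open V) -> F (basic_to_open U)} :=
  bij_inv (Floc.2 V U VU).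

Fact inverse_map_id V (VV : incl V V) x : inverse_map VV x = x.
Proof.
rewrite -[RHS](bij_invK (Floc.2 V V VV)); congr (inverse_map VV _).
by rewrite fun_map_id.
Qed.

Fact inverse_map_comp U V W (UV : incl U V) (VW : incl V W) (UW : incl U W) x :
  inverse_map UW x = inverse_map VW (inverse_map UV x).
Proof.
apply: (canLR (bij_invK (Floc.2 U W UW))).
rewrite (@fun_map_comp _ _ F (basic_to_open W) (basic_to_open V)
  (basic_to_open U) VW UV UW).
by rewrite /inverse_map !bij_invKV.
Qed.

Definition inverse_functor : functor (@incl X (@basic R X)) :=
  @Functor basics (@incl X (@basic R X)) (fun U => F (basic_to_open U))
    inverse_map inverse_map_id inverse_map_comp.

Definition colocal_of_local : copresheaf X := gen_cosheaf inverse_functor.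
End Correspondence.

Definition equivalent (C : copresheaf X) (F : presheaf X)
    (Floc : is_local_system F) : Prop :=
  functor_iso C (colocal_of_local Floc).

End Constructible.

Record bisheaf (R : realType) (X : topologicalType) := Bisheaf {
  upper : presheaf X;
  lower : copresheaf X;
  upper_sheaf : is_sheaf upper;
  lower_cosheaf : is_cosheaf lower;
  bimap : forall U : opens X, path_connected R (val U) ->
    {additive upper U -> lower U};
  bimapP : forall (U V : opens X) (Upc : path_connected R (val U))
    (Vpc : path_connected R (val V)) (VU : val V `<=` val U) (x : upper U),
    bimap Upc x = fun_map lower (VU : incl V U)
      (bimap Vpc (fun_map upper (VU : rincl U V) x)) }.

Section Isobisheaf.
Variables (R : realType) (X : stratSpace R).

Definition bisheaf_constructible (I : bisheaf R X) : Prop :=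
  sheaf_constructible (upper I) /\ cosheaf_constructible (lower I).

Definition is_episheaf (F : presheaf X) : Prop :=
  forall (V U : basics X) (VU : val V `<=` val U),
    forall y, exists x,
      fun_map F (VU : rincl (basic_to_open U) (basic_to_open V)) x = y.

Definition is_monocosheaf (F : copresheaf X) : Prop :=
  forall (V U : basics X) (VU : val V `<=` val U),
    injective (fun_map F (VU : incl (basic_to_open V) (basic_to_open U))).

Definition is_isobisheaf (I : bisheaf R X) : Prop :=
  [/\ bisheaf_constructible I, is_episheaf (upper I) & is_monocosheaf (lower I)].

Variables (I : bisheaf R X) (Iiso : is_isobisheaf I).

Definition basic_bimap (U : basics X) :
    {additive upper I (basic_to_open U) -> lower I (basic_to_open U)} :=
  @bimap R X I (basic_to_open U) (basic_path_connected (set_valP U)).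

Lemma basic_bimapP (V U : basics X) (VU : val V `<=` val U) x :
  basic_bimap U x =
  fun_map (lower I) (VU : incl (basic_to_open V) (basic_to_open U))
    (basic_bimap V
      (fun_map (upper I) (VU : rincl (basic_to_open U) (basic_to_open V)) x)).
Proof. exact: bimapP. Qed.

Fact im_subproof (V U : basics X) (VU : incl V U) y :
  in_im (basic_bimap V) y ->
  in_im (basic_bimap U)
    (fun_map (lower I) (VU : incl (basic_to_open V) (basic_to_open U)) y).
Proof.
move=> /asboolP[x <-]; apply/asboolP.
have [_ Iepi _] := Iiso; have [x' <-] := Iepi _ _ VU x.
by exists x'; exact: basic_bimapP.
Qed.

Definition im_map (V U : basics X) (VU : incl V U) :
    {additive im (basic_bimap V) -> im (basic_bimap U)} :=
  im_restr (im_subproof VU).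

Fact im_map_id V (VV : incl V V) x : im_map VV x = x.
Proof. by apply: val_inj; exact: fun_map_id. Qed.

Fact im_map_comp U V W (UV : incl U V) (VW : incl V W) (UW : incl U W) x :
  im_map UW x = im_map VW (im_map UV x).
Proof. by apply: val_inj; exact: fun_map_comp. Qed.

Definition im_functor : functor (@incl X (@basic R X)) :=
  Functor im_map_id im_map_comp.

Fact coim_subproof (U V : basics X) (VU : rincl U V) x :
  basic_bimap U x = 0 ->
  basic_bimap V
    (fun_map (upper I) (VU : rincl (basic_to_open U) (basic_to_open V)) x) = 0.
Proof.
have [_ _ Imono] := Iiso => x0; apply: (Imono _ _ VU).
by rewrite raddf0 -x0; apply/esym; exact: basic_bimapP.
Qed.

Definition coim_map (U V : basics X) (VU : rincl U V) :
    {additive coim (basic_bimap U) -> coim (basic_bimap V)} :=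
  coim_ind (coim_subproof VU).

Fact coim_map_id U (UU : rincl U U) x : coim_map UU x = x.
Proof.
elim/quotW: x => x; rewrite [LHS](coim_ind_funE (coim_subproof UU)).
by rewrite fun_map_id.
Qed.

Fact coim_map_comp U V W (UV : rincl U V) (VW : rincl V W) (UW : rincl U W) x :
  coim_map UW x = coim_map VW (coim_map UV x).
Proof.
elim/quotW: x => x; rewrite [LHS](coim_ind_funE (coim_subproof UW)).
transitivity (coim_map VW
  (\pi_(coim (basic_bimap V))
    (fun_map (upper I) (UV : rincl (basic_to_open U) (basic_to_open V)) x))).
  rewrite [RHS](coim_ind_funE (coim_subproof VW)).
  by congr (\pi_(coim _) _); exact: fun_map_comp.
congr (coim_map VW _); apply/esym.
exact: (coim_ind_funE (coim_subproof UV)).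
Qed.

Definition coim_functor : functor (@rincl X (@basic R X)) :=
  Functor coim_map_id coim_map_comp.

Definition im_cosheaf : copresheaf X := gen_cosheaf im_functor.
Definition coim_sheaf : presheaf X := gen_sheaf coim_functor.

End Isobisheaf.

(* Main.v *)
Require Import Defs.
From mathcomp Require Import all_boot all_order all_algebra.
From mathcomp Require Import all_classical all_reals topology normedtype.
Set Implicit Arguments.
Unset Strict Implicit.
Unset Printing Implicit Defensive.
Import Order.TTheory GRing.Theory Num.Theory.
Import numFieldNormedType.Exports.
Import Defs.
Local Open Scope classical_set_scope.
Local Open Scope quotient_scope.
Local Open Scope ring_scope.

(* In an isobisheaf every map of basic opens is an isomorphism on images:
   it is injective because the lower cosheaf is mono, and surjective because
   I(U) factors through I(V).  Since coim is naturally isomorphic to im, both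
   functors on the basic opens are locally constant, and it remains to see that
   a locally constant functor G on the basic opens generates a sheaf (cosheaf).
   Given a cover of U and a basic open B of U, the basic opens of B lying in
   members of the cover induce, through the isomorphisms of G, a locally constant
   function on B; as B is connected this function is constant, which extends the
   gluing data from the small basic opens to B.  All of this relies on the basic
   opens being a basis of the topology. *)

(** * Connectedness and open maps *)

(** [A] is the union of the images of paths issued from one base point. Each image is connected, and
    all of them contain the base point. *)
Lemma path_connected_connected (R : realType) (X : topologicalType) (A : set X) :
  path_connected R A -> connected A.
Proof.
move=> [[x Ax] pc].
have /choice[g gP] : forall y, exists g : R -> X, A y ->
    [/\ {within `[0, 1], continuous g}, g 0 = x, g 1 = y &
        forall t, 0 <= t <= 1 -> A (g t)].
  move=> y; have [Ay|nAy] := pselect (A y).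
    by have [g ?] := pc x y Ax Ay; exists g.
  (* Outside [A] nothing is required of the path, so a constant one serves as default. *)
  by exists (fun=> x).
have -> : A = \bigcup_(y in A) (g y @` `[0, 1]).
  apply/seteqP; split => [y Ay|_ [y Ay [t + <-]]].
    have [_ _ g1 _] := gP y Ay; exists y => //; exists 1 => //.
    by rewrite /= in_itv /= ler01 lexx.
  by have [_ _ _] := gP y Ay; rewrite /= in_itv; apply.
apply: bigcup_connected.
  exists x => y Ay; have [_ g0 _ _] := gP y Ay; exists 0 => //.
  by rewrite /= in_itv /= ler01 lexx.
move=> y Ay; have [gc _ _ _] := gP y Ay.
by apply: connected_continuous_connected gc; exact: segment_connected.
Qed.

(** With [T] regarded as discrete, [f] is continuous on [A]; the set of points of [A] where [f]
    equals [f p] is therefore clopen in [A]. *)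
Lemma connected_locally_constant (X : topologicalType) (T : Type) (A : set X)
    (f : X -> T) : open A -> connected A ->
  (forall p, A p -> \forall q \near p, f q = f p) ->
  forall p q, A p -> A q -> f p = f q.
Proof.
move=> oA cA fA p q Ap Aq.
have oE (P : set T) : open [set r | A r /\ P (f r)].
  rewrite openE => r [Ar Pr]; have := open_nbhs_nbhs (conj oA Ar).
  by move: (fA r Ar); apply: filterS2 => s /= ->.
have E : [set r | A r /\ f r = f p] = A.
  apply: cA; first by exists p.
    exists [set r | A r /\ f r = f p]; first exact: (oE (eq^~ (f p))).
    by apply/seteqP; split => [r [Ar fr]|r [_ //]]; split.
  exists (~` [set r | A r /\ f r <> f p]).
    exact/open_closedC/(oE (fun y => y <> f p)).
  apply/seteqP; split => [r [Ar fr]|r [Ar nfr]]; split => //; first by case.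
  by apply: contrapT => fr; apply: nfr.
by move: Aq; rewrite -{1}E => -[].
Qed.

Lemma open_preimageI (X Y : topologicalType) (B : set X) (A : set Y) (f : X -> Y) :
  open B -> {in B, continuous f} -> open A -> open (B `&` f @^-1` A).
Proof.
rewrite !openE => oB fc oA x [Bx Afx]; rewrite /interior.
by apply: filterI; [exact: oB | apply: fc; [rewrite inE | exact: oA]].
Qed.

(** The image of [A] is its preimage under the inverse [g], which is continuous on the open set
    [range h]. *)
Lemma open_embedding_image (Y X : topologicalType) (h : Y -> X) (A : set Y) :
  open_embedding h -> open A -> open (h @` A).
Proof.
move=> [_ oh [g hK gc]] oA.
have -> : h @` A = range h `&` g @^-1` A.
  apply/seteqP; split => [_ [y Ay <-]|_ [[y _ <-]]]; rewrite /= hK; last by exists y.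
  by split => //; exists y.
by apply: open_preimageI => //; rewrite continuous_open_subspace in gc.
Qed.

Lemma open_embedding_open_map (Y X : topologicalType) (h : Y -> X) (g : X -> Y) :
  continuous h -> cancel h g -> (forall A, open A -> open (h @` A)) ->
  open_embedding h.
Proof.
move=> hc hK ho; split => //; first exact/ho/openT.
exists g => //; rewrite continuous_open_subspace; last exact/ho/openT.
move=> x; rewrite inE => -[y _ <-] B; rewrite hK nbhsE => -[C [oC Cy] CB].
rewrite /nbhs /=; apply: (@filterS _ _ _ (h @` C)).
  by move=> _ [z Cz <-]; rewrite /= hK; exact: CB.
by apply: open_nbhs_nbhs; split; [exact: ho | exists y].
Qed.

Lemma open_map_prod (X X' Y Y' : topologicalType) (f : X -> X') (g : Y -> Y') :
  (forall A, open A -> open (f @` A)) -> (forall A, open A -> open (g @` A)) ->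
  forall A, open A -> open ((fun z : X * Y => (f z.1, g z.2)) @` A).
Proof.
move=> fo go A; rewrite !openE => oA _ [[x y] Axy <-].
have [[B C] /= [+ +] BCA] := oA _ Axy.
rewrite /= !nbhsE => -[B' [oB Bx] BB] [C' [oC Cy] CC].
exists (f @` B', g @` C') => /=.
  split; apply: open_nbhs_nbhs; split; [exact: fo|by exists x|exact: go|by exists y].
move=> [_ _] /= [[u Bu <-] [v Cv <-]]; exists (u, v) => //.
by apply: BCA; split; [exact: BB | exact: CC].
Qed.

(** * Radial shrinking of normed spaces, cones and cylinders *)

Section Shrink.
Variables (R : realType) (e : R) (V : normedModType R).
Hypothesis e0 : 0 < e.

(** A radial homeomorphism of [V] onto the open ball of radius [e]: norms change by r |-> e r / (1 +
    r). The inverse [expand] changes them by s |-> s / (e - s) and is meaningful on that ball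
    only. *)
Definition shrink (v : V) : V := (e / (1 + `|v|)) *: v.
Definition expand (w : V) : V := (e - `|w|)^-1 *: w.

Let den_gt0 (v : V) : 0 < 1 + `|v|.
Proof. by rewrite ltr_pwDl. Qed.

Lemma norm_shrink v : `|shrink v| = e * `|v| / (1 + `|v|).
Proof. by rewrite normrZ ger0_norm ?divr_ge0 ?ltW // mulrAC. Qed.

Lemma norm_shrink_lt v : `|shrink v| < e.
Proof.
by rewrite norm_shrink ltr_pdivrMr // ltr_pM2l // ltrDr.
Qed.

Lemma shrinkK : cancel shrink expand.
Proof.
move=> v; rewrite /expand norm_shrink scalerA.
have d0 : 1 + `|v| != 0 by rewrite gt_eqF.
have -> : e - e * `|v| / (1 + `|v|) = e / (1 + `|v|).
  by rewrite -{1}(mulfK d0 e) -mulrBl -mulrBr addrK mulr1.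
by rewrite mulVf ?scale1r // mulf_neq0 ?invr_eq0 // gt_eqF.
Qed.

Lemma expandK w : `|w| < e -> shrink (expand w) = w.
Proof.
move=> we; have d0 : 0 < e - `|w| by rewrite subr_gt0.
rewrite /shrink /expand normrZ gtr0_norm ?invr_gt0 // scalerA.
have -> : 1 + (e - `|w|)^-1 * `|w| = e / (e - `|w|).
  by rewrite mulrC -{1}(divff (lt0r_neq0 d0)) -mulrDl subrK.
by rewrite invf_div [e * _]mulrC divfK ?divff ?scale1r // gt_eqF.
Qed.

Lemma shrink_continuous : continuous shrink.
Proof.
move=> v; apply: (@cvgZ _ _ _ _ _ (fun v : V => e / (1 + `|v|)) id) => //.
apply: cvgM; first exact: cvg_cst.
apply: cvgV; first by rewrite gt_eqF.
by apply: cvgD; [exact: cvg_cst | exact: norm_continuous].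
Qed.

Lemma expand_continuous : {in [set w | `|w| < e], continuous expand}.
Proof.
move=> w; rewrite inE /= => we.
apply: (@cvgZ _ _ _ _ _ (fun w : V => (e - `|w|)^-1) id) => //.
apply: cvgV; first by rewrite gt_eqF // subr_gt0.
by apply: cvgB; [exact: cvg_cst | exact: norm_continuous].
Qed.

Lemma shrink_open A : open A -> open (shrink @` A).
Proof.
move=> oA; have -> : shrink @` A = [set w | `|w| < e] `&` expand @^-1` A.
  apply/seteqP; split => [_ [v Av <-]|w [/= we Aw]].
    by split; rewrite /= ?shrinkK //; exact: norm_shrink_lt.
  by exists (expand w) => //; exact: expandK.
apply: open_preimageI => //; last exact: expand_continuous.
by apply: (@open_comp _ _ _ [set r | r < e]) => [x _|];
  [exact: norm_continuous | exact: open_lt].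
Qed.

End Shrink.

Lemma continuous_pair (X Y Z : topologicalType) (f : X -> Y) (g : X -> Z) x :
  {for x, continuous f} -> {for x, continuous g} ->
  {for x, continuous (fun z => (f z, g z))}.
Proof. by move=> fc gc; exact: (cvg_pair fc gc). Qed.

Lemma fst_continuous (X Y : topologicalType) : continuous (@fst X Y).
Proof. by move=> [x y]; exact: cvg_fst. Qed.

Lemma snd_continuous (X Y : topologicalType) : continuous (@snd X Y).
Proof. by move=> [x y]; exact: cvg_snd. Qed.

Section ConeMap.
Variables (R : realType) (L : topologicalType).
Local Notation halfline := (set_type (`[0, +oo[ : set R)).

Fact to_halfline_subproof (t : R) : `|t| \in (`[0, +oo[%classic : set R).
Proof. by rewrite inE /= in_itv /= andbT. Qed.

(** The absolute value makes this map total and continuous on [R]; it fixes the points of the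
    half-line. *)
Definition to_halfline (t : R) : halfline := SigSub (to_halfline_subproof t).

Lemma halfline_ge0 (t : halfline) : 0 <= val t.
Proof. by have := set_valP t; rewrite /= in_itv /= andbT. Qed.

Lemma to_halflineK (t : halfline) : to_halfline (val t) = t.
Proof. by apply: val_inj; rewrite /= ger0_norm // halfline_ge0. Qed.

Lemma to_halfline_continuous : continuous to_halfline.
Proof.
apply: (@continuous_comp_initial _ _ _ set_val); exact: norm_continuous.
Qed.

Lemma halfline_val_continuous : continuous (val : halfline -> R).
Proof. exact: (@initial_continuous _ _ set_val). Qed.

Lemma halfline_coord_continuous : continuous (fun y : L * halfline => val y.2).
Proof.
move=> y; apply: (@continuous_comp _ _ _ (@snd L halfline) val).
  exact: snd_continuous.
exact: halfline_val_continuous.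
Qed.

Definition height (c : cone R L) : R := if c is Some (_, t) then val t else 0.

Lemma height_proj (y : L * halfline) : height (cone_proj y) = val y.2.
Proof.
case: y => x t; rewrite /cone_proj /=; case: insubP => [u _ //|] /=.
by have := halfline_ge0 t; rewrite le_eqVlt => /orP[/eqP//|->].
Qed.

Lemma cone_proj0 x t : val t = 0 -> cone_proj (x, t) = (cone_pt : cone R L).
Proof. by move=> t0; rewrite /cone_proj /= t0 insubN // ltxx. Qed.

Lemma cone_projP (c : cone R L) : c = cone_pt \/
  exists x (t : halfline), 0 < val t /\ c = cone_proj (x, t).
Proof.
case: c => [[x [t t0]]|]; [right | by left].
exists x, (to_halfline t); rewrite /= gtr0_norm //; split => //.
rewrite /cone_proj /= gtr0_norm // insubT /=.
by congr (Some (_, _)); apply: val_inj.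
Qed.

Definition cone_map (f : R -> R) (c : cone R L) : cone R L :=
  if c is Some (x, t) then cone_proj (x, to_halfline (f (val t))) else cone_pt.

(** The condition [f 0 = 0] lets the radial map descend to the quotient: at height 0 both sides are
    the cone point. *)
Lemma cone_map_proj f y : f 0 = 0 ->
  cone_map f (cone_proj y) = cone_proj (y.1, to_halfline (f (val y.2))).
Proof.
case: y => x t f0; rewrite {1}/cone_proj /=; case: insubP => [u _ /= -> //|].
have := halfline_ge0 t; rewrite le_eqVlt => /orP[/eqP<- _ /=|->//].
by rewrite cone_proj0 //= f0 normr0.
Qed.

Lemma continuous_halfline_map (f : R -> R) (y : L * halfline) :
  {for val y.2, continuous f} ->
  {for y, continuous (fun z : L * halfline => (z.1, to_halfline (f (val z.2))))}.
Proof.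
move=> fc; apply: continuous_pair; first exact: fst_continuous.
apply: (@continuous_comp _ _ _ (fun y : L * halfline => f (val y.2)) to_halfline).
  apply: (@continuous_comp _ _ _ (fun y : L * halfline => val y.2) f); last exact: fc.
  exact: halfline_coord_continuous.
exact: to_halfline_continuous.
Qed.

(** This is the universal property of the quotient topology. *)
Lemma cone_continuous (Y : topologicalType) (f : cone R L -> Y) :
  continuous (f \o @cone_proj R L) -> continuous f.
Proof. by move=> /continuousP fc; apply/continuousP => A /fc. Qed.

Lemma cone_map_continuous f : f 0 = 0 -> continuous f -> continuous (cone_map f).
Proof.
move=> f0 fc; apply: cone_continuous.
have -> : cone_map f \o @cone_proj R L =
    @cone_proj R L \o (fun y => (y.1, to_halfline (f (val y.2)))).
  by apply/funext => y; exact: cone_map_proj.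
move=> y; apply: continuous_comp; last exact: cone_proj_continuous.
apply: continuous_halfline_map; exact: fc.
Qed.

Lemma subcone_cone_map (A : set L) f (c : cone R L) : (forall t, 0 < t -> 0 < f t) ->
  subcone A (cone_map f c) <-> subcone A c.
Proof.
move=> f_gt0; case: c => [[x [t t0]]|] //=.
by rewrite /cone_proj /= insubT ?normr_gt0 ?gt_eqF ?f_gt0.
Qed.

(** Tube lemma: the preimage of [K] in [L * halfline] is a neighborhood of every point of height 0,
    and compactness of [L] yields a bound on the height that is uniform in [x]. *)
Lemma cone_small_nbhs (K : set (cone R L)) : compact [set: L] ->
  nbhs (cone_pt : cone R L) K -> exists2 e, 0 < e & forall c, height c < e -> K c.
Proof.
move=> /compact_near_coveringP Lcpt Kpt.
have : \forall t \near (to_halfline 0), [set: L] `<=` [set x | K (cone_proj (x, t))].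
  refine (Lcpt halfline (nbhs (to_halfline 0)) (fun t x => K (cone_proj (x, t)))
    _ _) => x _.
  have : nbhs (x, to_halfline 0) (@cone_proj R L @^-1` K).
    by apply: cone_proj_continuous; rewrite cone_proj0 //= normr0.
  move=> [[B C] /= [Bx Ct] BC].
  by exists (B, C) => // -[y t] [/= By Ct']; exact: (BC (y, t)).
(* The half-line carries the subspace topology, so the neighborhood found contains the trace of an
   open [V] of [R]. *)
move=> [_ /= [[V oV <-] V0] VW].
have : nbhs (0 : R) V.
  by apply: open_nbhs_nbhs; split => //; rewrite -(normr0 R).
move=> /nbhs_ballP[e /= e0 eV]; exists e => // c ce.
have [->|[x [t [t0 ct]]]] := cone_projP c; first exact: nbhs_singleton.
rewrite ct; apply: (VW t) => //=; apply: eV.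
by move: ce; rewrite ct height_proj /ball /= sub0r normrN gtr0_norm.
Qed.

End ConeMap.

Section ConeShrink.
Variables (R : realType) (L : topologicalType) (e : R).
Hypothesis e0 : 0 < e.
Local Notation halfline := (set_type (`[0, +oo[ : set R)).

(** [R^o] is [R] as a normed space over itself, so heights are shrunk by the same formula as norms
    in the Euclidean factor. *)
Let s (t : R) : R := @shrink R e R^o t.
Let s' (t : R) : R := @expand R e R^o t.
Let s0 : s 0 = 0. Proof. exact: scaler0. Qed.
Let s'0 : s' 0 = 0. Proof. exact: scaler0. Qed.

Definition cone_shrink : cone R L -> cone R L := cone_map s.
Definition cone_expand : cone R L -> cone R L := cone_map s'.

Lemma shrink_gt0 t : 0 < t -> 0 < s t.
Proof. by move=> t0; rewrite mulr_gt0 // divr_gt0 // ltr_pwDl. Qed.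

Lemma cone_shrink_continuous : continuous cone_shrink.
Proof. by apply: cone_map_continuous => //; exact: (@shrink_continuous R e R^o). Qed.

Lemma cone_shrinkK : cancel cone_shrink cone_expand.
Proof.
move=> c; have [->//|[x [t [t0 ->]]]] := cone_projP c.
rewrite /cone_shrink /cone_expand !cone_map_proj //=.
rewrite ger0_norm ?(ltW (shrink_gt0 _)) // /s' /s (@shrinkK R e R^o) //.
by rewrite to_halflineK.
Qed.

Lemma cone_expandK c : height c < e -> cone_shrink (cone_expand c) = c.
Proof.
have [->//|[x [t [t0 ->]]]] := cone_projP c; rewrite height_proj /= => te.
have d0 : 0 <= s' (val t).
  by rewrite mulr_ge0 ?invr_ge0 ?subr_ge0 ?gtr0_norm // ltW.
rewrite /cone_shrink /cone_expand !cone_map_proj //= ger0_norm //.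
by rewrite /s' /s (@expandK R e R^o) ?to_halflineK //= gtr0_norm.
Qed.

Lemma height_shrink c : height (cone_shrink c) < e.
Proof.
have [->//|[x [t [t0 ->]]]] := cone_projP c.
by rewrite /cone_shrink cone_map_proj // height_proj /=; exact: (@norm_shrink_lt R e R^o).
Qed.

(** Openness is tested on [L * halfline]. There the image of [A] is cut out by the heights below [e]
    together with a preimage under the expanding map [w], which is continuous at those heights. *)
Lemma cone_shrink_open (A : set (cone R L)) : open A -> open (cone_shrink @` A).
Proof.
move=> oA; rewrite /open /= /cone_open.
pose w (y : L * halfline) := (y.1, to_halfline (s' (val y.2))).
have -> : @cone_proj R L @^-1` (cone_shrink @` A) =
    [set y : L * halfline | val y.2 < e] `&` w @^-1` (@cone_proj R L @^-1` A).
  apply/seteqP; split => [y [c Ac cy]|y [/= ye Aw]].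
    split; first by rewrite /= -height_proj -cy height_shrink.
    by rewrite /w /= -(cone_map_proj _ s'0) -cy -/cone_expand cone_shrinkK.
  exists (cone_expand (cone_proj y)); first by rewrite /cone_expand cone_map_proj.
  by rewrite cone_expandK // height_proj.
apply: open_preimageI => //.
- by apply: (@open_comp _ _ _ [set r | r < e]) => [y _|];
    [exact: halfline_coord_continuous | exact: open_lt].
- move=> y; rewrite inE /= => ye; apply: continuous_halfline_map.
  apply: (@expand_continuous R e R^o).
  by rewrite inE /= ger0_norm // halfline_ge0.
Qed.

End ConeShrink.

Lemma continuous_map_prod (X X' Y Y' : topologicalType) (f : X -> X') (g : Y -> Y') :
  continuous f -> continuous g -> continuous (fun z : X * Y => (f z.1, g z.2)).
Proof.
move=> fc gc z; apply: continuous_pair.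
  by apply: (@continuous_comp _ _ _ fst f); [exact: fst_continuous | exact: fc].
by apply: (@continuous_comp _ _ _ snd g); [exact: snd_continuous | exact: gc].
Qed.

Section Shrunk.
Variables (R : realType) (d : nat) (L : topologicalType) (e : R).
Hypothesis e0 : 0 < e.

Definition cylinder_shrink (z : 'rV[R]_d * cone R L) : 'rV[R]_d * cone R L :=
  (shrink e z.1, cone_shrink e z.2).

Definition cylinder_expand (z : 'rV[R]_d * cone R L) : 'rV[R]_d * cone R L :=
  (expand e z.1, cone_expand e z.2).

Lemma cylinder_shrink_continuous : continuous cylinder_shrink.
Proof.
exact: (continuous_map_prod (@shrink_continuous R e 'rV[R]_d)
  (@cone_shrink_continuous R L e)).
Qed.

Lemma cylinder_shrink_open A : open A -> open (cylinder_shrink @` A).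
Proof.
exact: (open_map_prod (shrink_open e0) (cone_shrink_open e0)).
Qed.

Lemma cylinder_shrink0 : cylinder_shrink (0, cone_pt) = (0, cone_pt).
Proof. by rewrite /cylinder_shrink /shrink /= scaler0. Qed.

Lemma cylinder_shrinkK :
  cancel cylinder_shrink cylinder_expand.
Proof. by move=> [v c]; rewrite /cylinder_expand /= shrinkK // cone_shrinkK. Qed.

Lemma open_embedding_shrink (X : topologicalType) (h : 'rV[R]_d * cone R L -> X) :
  open_embedding h -> open_embedding (h \o cylinder_shrink).
Proof.
move=> he; have [hc oh [g hK _]] := he.
apply: (@open_embedding_open_map _ _ _ (cylinder_expand \o g)).
- move=> z; apply: (@continuous_comp _ _ _ cylinder_shrink h); last exact: hc.
  exact: cylinder_shrink_continuous.
- by move=> z; rewrite /= hK; exact: cylinder_shrinkK.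
- move=> A oA; rewrite -image_comp; apply: open_embedding_image => //.
  exact: cylinder_shrink_open.
Qed.

(** Shrinking keeps the point of [L] and preserves being the cone point, and the filtration depends
    on nothing else. *)
Lemma prod_cone_filtration_shrink (G : int -> set L) i z :
  prod_cone_filtration G i (cylinder_shrink z) <-> prod_cone_filtration G i z.
Proof.
by split=> -[? zG]; split => //; apply/(subcone_cone_map _ _ (shrink_gt0 e0)).
Qed.

Lemma local_param_shrink (n : int) (X : topologicalType) (F : int -> set X) p
    (G : int -> set L) (h : 'rV[R]_d * cone R L -> X) :
  local_param n F p G h -> local_param n F p G (h \o cylinder_shrink).
Proof.
move=> [Fp he hF h0]; split => //; first exact: open_embedding_shrink.
- move=> i i1 i2; have [_ _ [g hK _]] := he.
  (* Injectivity of [h] turns the equality of images into a pointwise equivalence. *)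
  have FE z : F i (h z) <-> prod_cone_filtration G i z.
    have -> : F i (h z) = (h @` prod_cone_filtration G i) (h z).
      by rewrite hF //; apply/propext; split => [Fz|[]//]; split.
    split => [[z' Gz' zz']|Gz]; last by exists z.
    by rewrite -(hK z) -zz' hK.
  apply/seteqP; split => [_ [z Gz <-]|x [Fx [z _ zx]]]; last first.
    by move: Fx; rewrite -zx => /FE/prod_cone_filtration_shrink Gz; exists z.
  by split; [apply/FE/prod_cone_filtration_shrink | exists z].
- by rewrite /= cylinder_shrink0.
Qed.

End Shrunk.

(** * Basic opens form a basis *)

Section BasicBasis.
Variables (R : realType) (X : stratSpace R).

(** [d] is the least index of a skeleton containing [p]. For [d = 0] the skeleton below is the empty
    one of index -1; otherwise minimality excludes [p] from it. *)
Lemma pure_part_cover (p : X) :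
  exists2 d : nat, d%:Z <= dim X & @pure_part R X d p.
Proof.
have [n1 _ _ _ [F0 Fn Fle] _] := stratSpaceP X.
(* A negative dimension is -1, and then the whole space is the empty skeleton. *)
case: (ltP (dim X) 0) => n0.
  have nE : dim X = -1 by apply/eqP; rewrite eq_le n1 andbT -ltzD1.
  have : skeleton X (dim X) p by rewrite Fn.
  by rewrite nE F0.
have [m mE] : exists m : nat, dim X = m%:Z by exists `|dim X|%N; rewrite gez0_abs.
have ex : exists k : nat, `[< skeleton X k%:Z p >].
  by exists m; apply/asboolP; rewrite -mE Fn.
case: (ex_minnP ex) => k /asboolP Fk kmin; exists k.
  by rewrite mE lez_nat; apply: kmin; apply/asboolP; rewrite -mE Fn.
split => //; case: k Fk kmin => [|k] Fk kmin; first by rewrite sub0r F0.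
rewrite intS [1 + _]addrC addrK => Fk'.
by have := kmin k; rewrite ltnn => /(_ (introT (asboolP _) Fk')).
Qed.

(* Rescaling R^d and the cone shrinks a local parameterization into any given
   neighborhood: compactness of L makes the sets of points of small height a
   neighborhood basis of the cone point. *)
Lemma basic_nbhs (p : X) (O : set X) : open O -> O p ->
  exists U : basics X, val U p /\ val U `<=` O.
Proof.
move=> oO Op; have [d dn pd] := pure_part_cover p.
have [_ _ _ _ _ loc] := stratSpaceP X.
have [L [G [h [Lcpt Lstrat hP]]]] := loc d p dn pd.
have [_ [hc _ _] _ h0] := hP.
have : nbhs (0 : 'rV[R]_d, cone_pt : cone R L) (h @^-1` O).
  by apply: hc; rewrite h0; apply: open_nbhs_nbhs.
move=> [[B C] /= [/nbhs_ballP[e1 /= e10 eB] Cpt] BC].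
have [e2 e20 eC] := cone_small_nbhs Lcpt Cpt.
pose e := Num.min e1 e2.
have e0 : 0 < e by rewrite lt_min e10.
have bU : basic (range (h \o @cylinder_shrink R d L e)).
  exists d, p, L, G, (h \o @cylinder_shrink R d L e); split => //.
  exact: local_param_shrink.
exists (SigSub (mem_set bU)); split.
  by exists (0, cone_pt) => //; rewrite /= cylinder_shrink0.
move=> _ [[v c] _ <-]; apply: (BC (_, _)); split => /=.
  apply: eB; rewrite -ball_normE /ball_ /= sub0r normrN.
  by apply: lt_le_trans (norm_shrink_lt e0 v) _; rewrite ge_min lexx.
by apply: eC; apply: lt_le_trans (height_shrink e0 c) _; rewrite ge_min lexx orbT.
Qed.

Lemma basic_nonempty (U : basics X) : exists p, val U p.
Proof. by have [[p Up] _] := basic_path_connected (set_valP U); exists p. Qed.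

(* [f B] stands for the value at the points of B of a function on the connected
   set U, which the second hypothesis makes locally constant. *)
Lemma basic_germ_constant (U : basics X) (T : Type) (small : basics X -> Prop)
    (f : basics X -> T) :
  (forall p, val U p -> exists2 B, small B & val B p /\ val B `<=` val U) ->
  (forall B C, val B `<=` val C -> small C -> val C `<=` val U ->
     small B /\ f B = f C) ->
  forall B C, small B -> small C -> val B `<=` val U -> val C `<=` val U ->
    f B = f C.
Proof.
move=> ex mono B C sB sC BU CU.
have [[q0 Bq0] [r0 Cr0]] := (basic_nonempty B, basic_nonempty C).
(* Two small basic opens through a common point are compared on a basic open contained in both. *)
have key B1 B2 p : small B1 -> small B2 -> val B1 `<=` val U -> val B2 `<=` val U ->
    val B1 p -> val B2 p -> f B1 = f B2.
  move=> s1 s2 B1U B2U p1 p2.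
  have [D [Dp D12]] := basic_nbhs (openI (basic_open (set_valP B1))
    (basic_open (set_valP B2))) (conj p1 p2).
  have [_ <-] := mono D B1 (subset_trans D12 (@subIsetl _ _ _)) s1 B1U.
  by have [_ <-] := mono D B2 (subset_trans D12 (@subIsetr _ _ _)) s2 B2U.
(* [f (g p)] does not depend on the small basic open [g p] chosen around [p], so the function p |->
   [f (g p)] is constant on each [g p]. For [p] outside [U] the value [U] is a default. *)
have /choice[g gP] : forall p, exists D, val U p ->
    [/\ small D, val D p & val D `<=` val U].
  move=> p; have [Up|nUp] := pselect (val U p); last by exists U.
  by have [D sD [Dp DU]] := ex p Up; exists D.
have gE p D : small D -> val D `<=` val U -> val D p -> f (g p) = f D.
  move=> sD DU Dp; have [sg gp gU] := gP p (DU p Dp).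
  exact: (key _ _ p).
rewrite -(gE q0 B) // -(gE r0 C) //.
apply: (@connected_locally_constant _ _ (val U) (fun p => f (g p))).
- exact: basic_open (set_valP U).
- exact: path_connected_connected (basic_path_connected (set_valP U)).
- move=> p Up; have [sD Dp DU] := gP p Up.
  have : nbhs p (val (g p)).
    by apply: open_nbhs_nbhs; split => //; exact: basic_open (set_valP _).
  by apply: filterS => q Dq; exact: gE.
- exact: BU.
- exact: CU.
Qed.

End BasicBasis.

(** * Bijections, isomorphic functors and the first isomorphism theorem *)

Lemma inj_surj_bij (A B : Type) (f : A -> B) :
  injective f -> (forall y, exists x, f x = y) -> bijective f.
Proof.
by move=> fI /choice[g gK]; exists g => // x; apply: fI; rewrite gK.
Qed.

Lemma bij_surj (A B : Type) (f : A -> B) y : bijective f -> exists x, f x = y.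
Proof. by move=> [g _ gK]; exists (g y). Qed.

Lemma bij_square (A B A' B' : Type) (f : A -> B) (f' : A' -> B') (a : A -> A')
    (b : B -> B') : bijective a -> bijective b ->
  (forall x, f' (a x) = b (f x)) -> bijective f <-> bijective f'.
Proof.
move=> [a' aK a'K] [b' bK b'K] fab; split=> fb.
  apply: (eq_bij (bij_comp (bij_comp (Bijective bK b'K) fb) (Bijective a'K aK))) => x /=.
  by rewrite -fab a'K.
apply: (eq_bij (bij_comp (bij_comp (Bijective b'K bK) fb) (Bijective aK a'K))) => x /=.
by rewrite fab bK.
Qed.

Section FunctorIso.
Variables (I : Type) (le : I -> I -> Prop).

Lemma functor_iso_sym (D E : functor le) : functor_iso D E -> functor_iso E D.
Proof.
move=> [phi [phib phin]]; exists (fun i => bij_inv (phib i)); split.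
  by move=> i; exists (phi i); [exact: bij_invKV | exact: bij_invK].
move=> i j h x; apply: (canLR (bij_invK (phib j))).
by rewrite phin bij_invKV.
Qed.

End FunctorIso.

Section FirstIsomorphism.
Variables (A B : zmodType) (f : {additive A -> B}).

Fact coim_to_im_subproof (x : coim f) : in_im f (f (repr x)).
Proof. by apply/asboolP; exists (repr x). Qed.

Definition coim_to_im_fun (x : coim f) : im f := Sub _ (coim_to_im_subproof x).

Lemma coim_to_im_funE x : val (coim_to_im_fun (\pi_(coim f) x)) = f x.
Proof. exact: coim_reprK. Qed.

Fact coim_to_im_additive : zmod_morphism coim_to_im_fun.
Proof.
elim/quotW=> x; elim/quotW=> y; apply: val_inj.
rewrite -coim_piN -coim_piD coim_to_im_funE raddfB [RHS]raddfB.
by congr (_ - _); apply/esym/coim_to_im_funE.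
Qed.

Definition coim_to_im : {additive coim f -> im f} := mk_additive coim_to_im_additive.

Lemma coim_to_im_bij : bijective coim_to_im.
Proof.
apply: inj_surj_bij => [|y].
  elim/quotW=> x; elim/quotW=> y xy; apply: coim_eq.
  by rewrite -!coim_to_im_funE; exact: (congr1 val xy).
have [x xy] := asboolW (valP y); exists (\pi_(coim f) x); apply: val_inj.
by rewrite [LHS]coim_to_im_funE.
Qed.

End FirstIsomorphism.

(** * Basic opens subordinate to a cover *)

Section SmallBasics.
Variables (R : realType) (X : stratSpace R).
Variables (U : opens X) (C : set (set X)) (UC : is_cover (val U) C).

Definition small (B : basics X) : Prop := exists W : set_type C, val B `<=` val W.

Lemma smallW (B B' : basics X) : val B' `<=` val B -> small B -> small B'.
Proof. by move=> BB [W BW]; exists W; exact: subset_trans BW. Qed.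

Lemma small_nbhs (B : basics X) p : val B `<=` val U -> val B p ->
  exists2 B' : basics X, small B' & val B' p /\ val B' `<=` val B.
Proof.
case: UC => Copen CU _ BU Bp; have := BU p Bp; rewrite -CU => -[W CW Wp].
have [B' [B'p B'BW]] := basic_nbhs (openI (basic_open (set_valP B)) (Copen W CW))
  (conj Bp Wp).
exists B'; first by exists (SigSub (mem_set CW)) => x /B'BW[].
by split => // x /B'BW[].
Qed.

Lemma small_sub (B : basics X) : val B `<=` val U ->
  exists2 B' : basics X, small B' & val B' `<=` val B.
Proof.
move=> BU; have [p Bp] := basic_nonempty B.
by have [B' sB' []] := small_nbhs BU Bp; exists B'.
Qed.

(** The intersection of [W] and [W'] is only a union of members of the cover. Data on [W] and [W']
    are therefore compared on a smaller [B'], inside a member [V] of the cover contained in both. *)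
Lemma basic_sub_meet (B : basics X) (W W' : set_type C) :
  val B `<=` val W -> val B `<=` val W' ->
  exists (V : set_type C) (B' : basics X),
    [/\ val V `<=` val W, val V `<=` val W', val B' `<=` val B & val B' `<=` val V].
Proof.
case: UC => Copen _ Cmeet BW BW'; have [p Bp] := basic_nonempty B.
have [D DC WW'] := Cmeet _ _ (set_valP W) (set_valP W').
have : (val W `&` val W') p by split; [exact: BW | exact: BW'].
rewrite WW' => -[V DV Vp].
have VWW' : V `<=` val W `&` val W' by rewrite WW' => x Vx; exists V.
have [B' [_ B'BV]] := basic_nbhs
  (openI (basic_open (set_valP B)) (Copen V (DC V DV))) (conj Bp Vp).
exists (SigSub (mem_set (DC V DV))), B'; split => x /=.
- by move=> /VWW'[].
- by move=> /VWW'[].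
- by move=> /B'BV[].
- by move=> /B'BV[].
Qed.

End SmallBasics.

(** * Locally constant functors generate sheaves and cosheaves *)

Section LocallyConstantSheaf.
Variables (R : realType) (X : stratSpace R) (G : functor (@rincl X (@basic R X))).
Hypothesis Gbij : forall (U V : basics X) (VU : rincl U V), bijective (fun_map G VU).

Section Gluing.
Variables (U : opens X) (C : set (set X)) (UC : is_cover (val U) C).
Variable y : lim (reindex (member UC) (gen_sheaf G)).

Let Y (W : set_type C) (B : basics X) (BW : val B `<=` val W) : G B :=
  lim_val (lim_val y W) (exist _ B BW : basics_in (member UC W)).

Let Y_res W B B' (BW : val B `<=` val W) (B'W : val B' `<=` val W)
  (h : rincl B B') : fun_map G h (Y BW) = Y B'W.
Proof.
exact: (@limP _ _ _ (lim_val y W) (exist _ B BW : basics_in (member UC W))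
  (exist _ B' B'W : basics_in (member UC W)) h).
Qed.

Let Y_member W W' B (WW' : val W' `<=` val W) (BW : val B `<=` val W)
  (BW' : val B `<=` val W') : Y BW = Y BW'.
Proof.
rewrite /Y -(@limP _ _ _ y W W' WW') /= /basics_in_widen /=.
by congr (lim_val (lim_val y W) (exist _ B _)); exact: Prop_irrelevance.
Qed.

(** Compatibility of [y] relates nested members only. As restrictions of [G] are injective, equality
    may be tested on a [B'] inside a member contained in both [W] and [W']. *)
Let Y_indep W W' B (BW : val B `<=` val W) (BW' : val B `<=` val W') : Y BW = Y BW'.
Proof.
have [V [B' [VW VW' B'B B'V]]] := basic_sub_meet UC BW BW'.
have B'W := subset_trans B'V VW; have B'W' := subset_trans B'V VW'.
apply: (bij_inj (Gbij (B'B : rincl B B'))).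
rewrite (Y_res BW B'W) (Y_res BW' B'W').
by rewrite (Y_member VW B'W B'V) (Y_member VW' B'W' B'V).
Qed.

(** The values of [y] on the small basic opens of [B0] are transported back to the single group
    [G B0], where they can be compared. The value 0 is a default for the other [B]. *)
Let germ (B0 B : basics X) : G B0 :=
  match pselect (small C B), pselect (rincl B0 B) with
  | left sB, left h => bij_inv (Gbij h) (Y (projT2 (cid sB)))
  | _, _ => 0
  end.

Let germE B0 B W (BW : val B `<=` val W) (h : rincl B0 B) :
  fun_map G h (germ B0 B) = Y BW.
Proof.
rewrite /germ; case: pselect => [sB|]; last by case; exists W.
case: pselect => [h'|//]; rewrite (Prop_irrelevance h h') bij_invKV.
exact: Y_indep.
Qed.

(** The element sought is the germ at any one small [P] inside [B0]; by [basic_germ_constant] all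
    other germs agree with it. *)
Lemma glue_basic (B0 : basics X) : val B0 `<=` val U ->
  exists a : G B0, forall (W : set_type C) (B : basics X) (BW : val B `<=` val W)
    (h : rincl B0 B),
    fun_map G h a = lim_val (lim_val y W) (exist _ B BW : basics_in (member UC W)).
Proof.
move=> B0U; have [P sP PB0] := small_sub UC B0U.
exists (germ B0 P) => W B BW h; rewrite -/(Y BW) -(germE BW h).
congr (fun_map G h _).
apply: (@basic_germ_constant _ _ B0 _ (small C)) => //; last by exists W.
- by move=> p B0p; exact: (small_nbhs UC).
- move=> B1 B2 B12 sB2 B20; have [W2 BW2] := sB2.
  split; first exact: smallW sB2.
  have BW1 := subset_trans B12 BW2.
  apply: (bij_inj (Gbij (subset_trans B12 B20 : rincl B0 B1))).
  rewrite (germE BW1) -(Y_res BW2 BW1 B12) -(germE BW2 B20).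
  exact/esym/(@fun_map_comp _ _ G B0 B2 B1).
Qed.

End Gluing.

(** Every basic open contains a small one and restrictions of [G] are injective, so injectivity and
    the compatibility of the glued family are both tested on small basic opens. Existence is
    [glue_basic]. *)
Lemma gen_sheaf_is_sheaf : is_sheaf (gen_sheaf G).
Proof.
move=> U C UC; apply: inj_surj_bij => [x x' xx'|y].
  apply: lim_eqP => -[B BU]; have [B' [W B'W] B'B] := small_sub UC BU.
  apply: (bij_inj (Gbij (B'B : rincl B B'))).
  have := congr1 (fun z : lim (reindex (member UC) (gen_sheaf G)) =>
    lim_val (lim_val z W)
    (exist _ B' B'W : basics_in (member UC W))) xx'.
  rewrite /= /basics_in_widen /=; set h := (X in exist _ B' X) => xx.
  rewrite (@limP _ _ _ x (exist _ B BU) (exist _ B' h) B'B).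
  by rewrite (@limP _ _ _ x' (exist _ B BU) (exist _ B' h) B'B).
pose a (B : basics_in U) : G (sval B) := sval (cid (glue_basic y (svalP B))).
have aP B W B' (BW : val B' `<=` val W) (h : rincl (sval B) B') : fun_map G h (a B) =
    lim_val (lim_val y W) (exist _ B' BW : basics_in (member UC W)).
  exact: (svalP (cid (glue_basic y (svalP B)))).
have aC : compatible (D := reindex (@basics_in_val R X U) G) a.
  move=> B B' h; have [B1 [W B1W] B1B'] := small_sub UC (svalP B').
  apply: (bij_inj (Gbij (B1B' : rincl (sval B') B1))).
  rewrite (aP B' W B1 B1W) -(aP B W B1 B1W (subset_trans B1B' h)).
  exact/esym/(@fun_map_comp _ _ G (sval B) (sval B') B1).
exists (Lim aC); apply: lim_eqP => W; apply: lim_eqP => -[B BW].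
have BU : val B `<=` val U := subset_trans BW (@member_sub _ _ _ UC W).
rewrite -(aP (exist _ B BU) W B BW (@subset_refl _ _)) fun_map_id /=.
rewrite /basics_in_widen /=.
by rewrite (Prop_irrelevance (subset_trans _ _) BU).
Qed.

End LocallyConstantSheaf.

Lemma gen_cosheaf_mapE (R : realType) (X : stratSpace R)
    (G : functor (@incl X (@basic R X))) (V U : opens X) (VU : incl V U)
    (B : basics_in V) (x : G (sval B)) :
  fun_map (gen_cosheaf G) VU (colim_in (reindex (@basics_in_val R X V) G) B x) =
  colim_in (reindex (@basics_in_val R X U) G) (basics_in_widen VU B) x.
Proof. exact: colim_descE. Qed.

Section LocallyConstantCosheaf.
Variables (R : realType) (X : stratSpace R) (G : functor (@incl X (@basic R X))).
Hypothesis Gbij : forall (V U : basics X) (VU : incl V U), bijective (fun_map G VU).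

Section Cutting.
Variables (U : opens X) (C : set (set X)) (UC : is_cover (val U) C).

Let Z : zmodType := colim (reindex (member UC) (gen_cosheaf G)).

Definition cut_in (W : set_type C) (B : basics X) (BW : val B `<=` val W) :
    {additive G B -> Z} :=
  [the {additive G B -> Z} of
    colim_in (reindex (member UC) (gen_cosheaf G)) W \o
    colim_in (reindex (@basics_in_val R X (member UC W)) G)
      (exist _ B BW : basics_in (member UC W))].

Lemma cut_inE W B (BW : val B `<=` val W) x : cut_in BW x =
  colim_in (reindex (member UC) (gen_cosheaf G)) W
    (colim_in (reindex (@basics_in_val R X (member UC W)) G)
      (exist _ B BW : basics_in (member UC W)) x).
Proof. by []. Qed.

Lemma cut_in_ext W B B' (BW : val B `<=` val W) (B'W : val B' `<=` val W)
  (h : incl B B') x : cut_in B'W (fun_map G h x) = cut_in BW x.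
Proof.
congr (colim_in _ W _).
exact: (@colim_in_cocone _ _ (reindex (@basics_in_val R X (member UC W)) G)
  (exist _ B BW) (exist _ B' B'W) h).
Qed.

Lemma cut_in_member W W' B (WW' : val W' `<=` val W) (BW : val B `<=` val W)
  (BW' : val B `<=` val W') x : cut_in BW x = cut_in BW' x.
Proof.
rewrite [RHS]cut_inE
  -(@colim_in_cocone _ _ (reindex (member UC) (gen_cosheaf G)) W' W WW').
congr (colim_in _ W _); rewrite [RHS]gen_cosheaf_mapE /basics_in_widen /=.
by rewrite (Prop_irrelevance (subset_trans _ _) BW).
Qed.

(** Dual to the sheaf case: [x] comes from a [B'] inside a member contained in both [W] and [W'],
    because extensions of [G] are surjective. *)
Lemma cut_in_indep W W' B (BW : val B `<=` val W) (BW' : val B `<=` val W') x :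
  cut_in BW x = cut_in BW' x.
Proof.
have [V [B' [VW VW' B'B B'V]]] := basic_sub_meet UC BW BW'.
have B'W := subset_trans B'V VW; have B'W' := subset_trans B'V VW'.
have [z <-] := bij_surj x (Gbij (B'B : incl B' B)).
rewrite (cut_in_ext B'W BW) (cut_in_ext B'W' BW').
by rewrite (cut_in_member VW B'W B'V) (cut_in_member VW' B'W' B'V).
Qed.

Lemma of_cover_cut W B (BW : val B `<=` val W) (BU : val B `<=` val U) x :
  of_cover_colim UC (gen_cosheaf G) (cut_in BW x) =
  colim_in (reindex (@basics_in_val R X U) G) (exist _ B BU : basics_in U) x.
Proof.
rewrite cut_inE colim_descE gen_cosheaf_mapE /basics_in_widen /=.
by rewrite (Prop_irrelevance (subset_trans _ _) BU).
Qed.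

(** The element [a] is pulled back to a small [B] inside [B0] and then sent to the colimit over the
    cover; 0 is again a default. *)
Let germ (B0 : basics X) (a : G B0) (B : basics X) : Z :=
  match pselect (small C B), pselect (incl B B0) with
  | left sB, left h => cut_in (projT2 (cid sB)) (bij_inv (Gbij h) a)
  | _, _ => 0
  end.

Let germE B0 B W (BW : val B `<=` val W) (h : incl B B0) b :
  germ (fun_map G h b) B = cut_in BW b.
Proof.
rewrite /germ; case: pselect => [sB|]; last by case; exists W.
case: pselect => [h'|//]; rewrite (Prop_irrelevance h h') bij_invK.
exact: cut_in_indep.
Qed.

(** Defining [q] through one fixed small [P] makes it additive at once; constancy of the germs shows
    that every other small [B] gives the same map. *)
Lemma cut_basic (B0 : basics X) : val B0 `<=` val U ->
  exists q : {additive G B0 -> Z},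
    forall (W : set_type C) (B : basics X) (BW : val B `<=` val W) (h : incl B B0) b,
    q (fun_map G h b) = cut_in BW b.
Proof.
move=> B0U; have [P [WP PWP] PB0] := small_sub UC B0U.
exists [the {additive G B0 -> Z} of cut_in PWP \o bij_inv (Gbij (PB0 : incl P B0))].
move=> W B BW h b; rewrite -(germE BW h).
rewrite -[RHS](@basic_germ_constant _ _ B0 _ (small C) (germ (fun_map G h b)) _ _ P) //.
- have [c cE] := bij_surj (fun_map G h b) (Gbij (PB0 : incl P B0)).
  by rewrite -cE (germE PWP); congr (cut_in PWP _); exact: bij_invK.
- by move=> p B0p; exact: (small_nbhs UC).
- move=> B1 B2 B12 sB2 B20; have [W2 BW2] := sB2.
  split; first exact: smallW sB2.
  have BW1 := subset_trans B12 BW2.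
  have [c <-] := bij_surj (fun_map G h b) (Gbij (subset_trans B12 B20 : incl B1 B0)).
  rewrite (germE BW1) (@fun_map_comp _ _ G B1 B2 B0 B12 B20) (germE BW2).
  by rewrite (cut_in_ext BW1).
- by exists WP.
- by exists W.
Qed.

End Cutting.

(** The maps of [cut_basic] assemble into an inverse of [of_cover_colim]. Both composites are
    compared with the identity on generators, in two stages for the colimit of colimits. *)
Lemma gen_cosheaf_is_cosheaf : is_cosheaf (gen_cosheaf G).
Proof.
move=> U C UC.
pose Z : zmodType := colim (reindex (member UC) (gen_cosheaf G)).
pose q (B : basics_in U) : {additive reindex (@basics_in_val R X U) G B -> Z} :=
  sval (cid (cut_basic UC (svalP B))).
have qE (B0 : basics_in U) W B (BW : val B `<=` val W) (h : incl B (sval B0)) b :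
    q B0 (fun_map G h b) = cut_in UC BW b.
  exact: (svalP (cid (cut_basic UC (svalP B0)))).
have qC : is_cocone (reindex (@basics_in_val R X U) G) q.
  move=> B B' h x; have [P [W PW] PB] := small_sub UC (svalP B).
  have [b <-] := bij_surj x (Gbij (PB : incl P (sval B))).
  rewrite (qE B _ _ PW) -(qE B' _ _ PW (subset_trans PB h)); congr (q B' _).
  exact/esym/(@fun_map_comp _ _ G P (sval B) (sval B')).
exists (colim_desc qC).
  apply: (@colim_ext _ _ _ _ ([the {additive _ -> _} of
    colim_desc qC \o of_cover_colim UC (gen_cosheaf G)]) idfun) => W.
  apply: (@colim_ext _ _ _ _ ([the {additive _ -> _} of
    colim_desc qC \o of_cover_colim UC (gen_cosheaf G) \o
    colim_in (reindex (member UC) (gen_cosheaf G)) W])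
    (colim_in (reindex (member UC) (gen_cosheaf G)) W)) => -[B BW] x.
  have BU : val B `<=` val U := subset_trans BW (@member_sub _ _ _ UC W).
  transitivity (colim_desc qC (of_cover_colim UC (gen_cosheaf G) (cut_in UC BW x))).
    by [].
  rewrite (of_cover_cut UC BW BU) colim_descE.
  (* [B] already lies in [W], so [qE] applies to the inclusion of [B] in itself. *)
  rewrite -[in LHS](@fun_map_id _ _ G B (@subset_refl _ (val B)) x).
  exact: (qE (exist _ B BU)).
apply: (@colim_ext _ _ _ _ ([the {additive _ -> _} of
  of_cover_colim UC (gen_cosheaf G) \o colim_desc qC]) idfun) => -[B BU] x.
have [P [W PW] PB] := small_sub UC BU.
have [b <-] := bij_surj x (Gbij (PB : incl P B)).
transitivity (of_cover_colim UC (gen_cosheaf G) (colim_desc qC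
  (colim_in (reindex (@basics_in_val R X U) G) (exist _ B BU : basics_in U)
    (fun_map G (PB : incl P B) b)))); first by [].
rewrite colim_descE (qE (exist _ B BU) _ _ PW).
rewrite (of_cover_cut UC PW (subset_trans PB BU)); apply/esym.
exact: (@colim_in_cocone _ _ (reindex (@basics_in_val R X U) G)
  (exist _ P (subset_trans PB BU)) (exist _ B BU) PB).
Qed.

End LocallyConstantCosheaf.

(** * Values of generated sheaves and cosheaves on basic opens *)

Section Generated.
Variables (R : realType) (X : stratSpace R).

Definition basic_self (U : basics X) : basics_in (basic_to_open U) :=
  exist _ U (@subset_refl _ (val U)).

(* [basic_self U] is the largest basic open contained in U, so that limits and
   colimits over the basic opens contained in U are attained there. *)
Lemma gen_sheaf_self_bij (G : functor (@rincl X (@basic R X))) (U : basics X) :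
  bijective (lim_proj (reindex (@basics_in_val R X (basic_to_open U)) G)
    (basic_self U)).
Proof.
apply: inj_surj_bij => [x y /= xy|a].
  apply: lim_eqP => -[B BU].
  rewrite -(@limP _ _ _ x (basic_self U) (exist _ B BU) BU).
  by rewrite -(@limP _ _ _ y (basic_self U) (exist _ B BU) BU) xy.
have aP : compatible (D := reindex (@basics_in_val R X (basic_to_open U)) G)
    (fun B => fun_map G (svalP B : rincl U (sval B)) a).
  by move=> B B' h; exact/esym/(@fun_map_comp _ _ G U (sval B) (sval B')).
by exists (Lim aP); exact: (@fun_map_id _ _ G U).
Qed.

Lemma gen_sheaf_basic_bij (G : functor (@rincl X (@basic R X))) (V U : basics X)
    (VU : rincl U V) : bijective (fun_map G VU) ->
  bijective (fun_map (gen_sheaf G)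
    (VU : rincl (basic_to_open U) (basic_to_open V))).
Proof.
apply: (bij_square (gen_sheaf_self_bij G U) (gen_sheaf_self_bij G V) _).2 => x.
exact: (@limP _ _ _ x (basic_self U)
  (basics_in_widen (VU : rincl (basic_to_open U) (basic_to_open V)) (basic_self V)) VU).
Qed.

Lemma gen_cosheaf_self_bij (G : functor (@incl X (@basic R X))) (U : basics X) :
  bijective (colim_in (reindex (@basics_in_val R X (basic_to_open U)) G)
    (basic_self U)).
Proof.
pose D := reindex (@basics_in_val R X (basic_to_open U)) G.
have qP : is_cocone D (fun B => fun_map G (svalP B : incl (sval B) U)).
  by move=> B B' h x; exact/esym/(@fun_map_comp _ _ G (sval B) (sval B') U).
exists (colim_desc qP) => [x|].
  by rewrite colim_descE; exact: (@fun_map_id _ _ G U).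
apply: (@colim_ext _ _ D _ ([the {additive _ -> _} of
  colim_in D (basic_self U) \o colim_desc qP]) idfun) => -[B BU] x.
transitivity (colim_in D (basic_self U) (colim_desc qP (colim_in D (exist _ B BU) x))).
  by [].
rewrite colim_descE.
apply: etrans (@colim_in_cocone _ _ D (exist _ B BU) (basic_self U) BU x).
by congr (colim_in D _ (fun_map G _ x)); exact: Prop_irrelevance.
Qed.

Lemma gen_cosheaf_basic_bij (G : functor (@incl X (@basic R X))) (V U : basics X)
    (VU : incl V U) : bijective (fun_map G VU) ->
  bijective (fun_map (gen_cosheaf G)
    (VU : incl (basic_to_open V) (basic_to_open U))).
Proof.
apply: (bij_square (gen_cosheaf_self_bij G V) (gen_cosheaf_self_bij G U) _).1 => x.
rewrite (gen_cosheaf_mapE (U := basic_to_open U)).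
apply/esym; exact: (@colim_in_cocone _ _
  (reindex (@basics_in_val R X (basic_to_open U)) G)
  (basics_in_widen (VU : incl (basic_to_open V) (basic_to_open U)) (basic_self V))
  (basic_self U) VU).
Qed.

(** * Functoriality of the generated cosheaf *)

Section GenCosheafIso.
Variables (D E : functor (@incl X (@basic R X))).
Variables (phi : forall B, {additive D B -> E B}).
Hypothesis phin : forall B B' (h : incl B B') x,
  phi B' (fun_map D h x) = fun_map E h (phi B x).

Fact gen_cosheaf_hom_subproof (U : opens X) :
  is_cocone (reindex (@basics_in_val R X U) D) (fun B =>
    [the {additive D (sval B) -> gen_cosheaf E U} of
      colim_in (reindex (@basics_in_val R X U) E) B \o phi (sval B)]).
Proof.
move=> B B' h x.
apply: etrans (@colim_in_cocone _ _ (reindex (@basics_in_val R X U) E) B B' h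
  (phi (sval B) x)).
by congr (colim_in _ B' _); exact: phin.
Qed.

Definition gen_cosheaf_hom U : {additive gen_cosheaf D U -> gen_cosheaf E U} :=
  colim_desc (@gen_cosheaf_hom_subproof U).

Lemma gen_cosheaf_homE U (B : basics_in U) x :
  gen_cosheaf_hom U (colim_in (reindex (@basics_in_val R X U) D) B x) =
  colim_in (reindex (@basics_in_val R X U) E) B (phi (sval B) x).
Proof. exact: colim_descE. Qed.

Lemma gen_cosheaf_hom_natural V U (VU : incl V U) x :
  gen_cosheaf_hom U (fun_map (gen_cosheaf D) VU x) =
  fun_map (gen_cosheaf E) VU (gen_cosheaf_hom V x).
Proof.
apply: (@colim_ext _ _ _ _
  [the {additive _ -> _} of gen_cosheaf_hom U \o fun_map (gen_cosheaf D) VU]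
  [the {additive _ -> _} of fun_map (gen_cosheaf E) VU \o gen_cosheaf_hom V]) => B y.
transitivity (gen_cosheaf_hom U (fun_map (gen_cosheaf D) VU
  (colim_in (reindex (@basics_in_val R X V) D) B y))); first by [].
transitivity (fun_map (gen_cosheaf E) VU (gen_cosheaf_hom V
  (colim_in (reindex (@basics_in_val R X V) D) B y))); last by [].
by rewrite gen_cosheaf_mapE !gen_cosheaf_homE gen_cosheaf_mapE.
Qed.

End GenCosheafIso.

Lemma gen_cosheaf_hom_cancel (D E : functor (@incl X (@basic R X)))
    (phi : forall B, {additive D B -> E B}) (psi : forall B, {additive E B -> D B})
    (phin : forall B B' (h : incl B B') x,
      phi B' (fun_map D h x) = fun_map E h (phi B x))
    (psin : forall B B' (h : incl B B') x,
      psi B' (fun_map E h x) = fun_map D h (psi B x)) U :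
  (forall B, cancel (phi B) (psi B)) ->
  cancel (gen_cosheaf_hom phin U) (gen_cosheaf_hom psin U).
Proof.
move=> phiK; apply: (@colim_ext _ _ _ _ [the {additive _ -> _} of
  gen_cosheaf_hom psin U \o gen_cosheaf_hom phin U] idfun) => B x.
transitivity (gen_cosheaf_hom psin U (gen_cosheaf_hom phin U
  (colim_in (reindex (@basics_in_val R X U) D) B x))); first by [].
by rewrite !gen_cosheaf_homE phiK.
Qed.

Lemma gen_cosheaf_iso (D E : functor (@incl X (@basic R X))) :
  functor_iso D E -> functor_iso (gen_cosheaf D) (gen_cosheaf E).
Proof.
move=> [phi [phib phin]].
pose psi B := bij_inv (phib B).
have psin B B' (h : incl B B') x : psi B' (fun_map E h x) = fun_map D h (psi B x).
  by apply: (canLR (bij_invK (phib B'))); rewrite phin bij_invKV.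
exists (gen_cosheaf_hom phin); split; last exact: gen_cosheaf_hom_natural.
move=> U; exists (gen_cosheaf_hom psin U); apply: gen_cosheaf_hom_cancel => B.
  exact: bij_invK.
exact: bij_invKV.
Qed.

End Generated.

(** * Images and coimages of an isobisheaf *)

Section ImageCoimage.
Variables (R : realType) (X : stratSpace R) (I : bisheaf R X) (hI : is_isobisheaf I).

Lemma im_map_bij (V U : basics X) (VU : incl V U) : bijective (im_map hI VU).
Proof.
have [_ _ Imono] := hI; apply: inj_surj_bij => [x y /(congr1 val) xy|y].
  by apply: val_inj; exact: (Imono _ _ VU).
have [x xy] := asboolW (valP y).
have imP : in_im (basic_bimap I V) (basic_bimap I V (fun_map (upper I)
    (VU : rincl (basic_to_open U) (basic_to_open V)) x)).
  by apply/asboolP; exists (fun_map (upper I)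
    (VU : rincl (basic_to_open U) (basic_to_open V)) x).
by exists (Sub _ imP); apply: val_inj; rewrite -xy; exact/esym/basic_bimapP.
Qed.

Lemma coim_mapE (U V : basics X) (VU : rincl U V) x :
  coim_map hI VU (\pi_(coim (basic_bimap I U)) x) =
  \pi_(coim (basic_bimap I V))
    (fun_map (upper I) (VU : rincl (basic_to_open U) (basic_to_open V)) x).
Proof. exact: (coim_ind_funE (coim_subproof hI VU)). Qed.

(** Coimages restrict while images extend, so the square has two opposite sides; on representatives
    it is the defining identity of a bisheaf. *)
Lemma coim_to_im_natural (V U : basics X) (VU : val V `<=` val U) x :
  coim_to_im (basic_bimap I U) x =
  im_map hI (VU : incl V U)
    (coim_to_im (basic_bimap I V) (coim_map hI (VU : rincl U V) x)).
Proof.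
elim/quotW: x => x; rewrite coim_mapE; apply: val_inj.
rewrite [LHS]coim_to_im_funE [RHS]/= coim_reprK.
exact: basic_bimapP.
Qed.

(** In the identity [coim_to_im_natural] all the other maps are bijective. *)
Lemma coim_map_bij (U V : basics X) (VU : rincl U V) : bijective (coim_map hI VU).
Proof.
have ib := coim_to_im_bij (basic_bimap I V).
have ib' := coim_to_im_bij (basic_bimap I U).
have ub : bijective (im_map hI (VU : incl V U) \o coim_to_im (basic_bimap I V)).
  exact: bij_comp (im_map_bij _) ib.
have [g gK Kg] := ub.
apply: (eq_bij (bij_comp (Bijective Kg gK) ib')) => x.
exact: (etrans (congr1 g (coim_to_im_natural VU x)) (gK (coim_map hI VU x))).
Qed.

Lemma coim_sheaf_local : is_local_system (coim_sheaf hI).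
Proof.
split; first by apply: gen_sheaf_is_sheaf => U V VU; exact: coim_map_bij.
by move=> V U VU; apply: gen_sheaf_basic_bij; exact: coim_map_bij.
Qed.

Lemma im_cosheaf_colocal : is_colocal_system (im_cosheaf hI).
Proof.
split; first by apply: gen_cosheaf_is_cosheaf => V U VU; exact: im_map_bij.
by move=> V U VU; apply: gen_cosheaf_basic_bij; exact: im_map_bij.
Qed.

(** On [U], sections of the generated sheaf are evaluated at [U] itself and then sent to the image
    by the first isomorphism theorem. *)
Lemma inverse_coim_iso :
  functor_iso (inverse_functor coim_sheaf_local) (im_functor hI).
Proof.
exists (fun U : basics X => [the {additive _ -> _} of
  coim_to_im (basic_bimap I U) \o
  lim_proj (reindex (@basics_in_val R X (basic_to_open U)) (coim_functor hI))
    (basic_self U)]); split=> [U|V U VU x].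
  exact: (bij_comp (coim_to_im_bij _) (gen_sheaf_self_bij (coim_functor hI) U)).
(* The map of [inverse_functor] inverts restriction, so [x] is the restriction of [y] and naturality
   reduces to [coim_to_im_natural]. *)
set y := fun_map _ VU x.
have -> : x = fun_map (coim_sheaf hI)
    (VU : rincl (basic_to_open U) (basic_to_open V)) y.
  by rewrite /y bij_invKV.
rewrite [LHS](coim_to_im_natural VU); congr (im_map hI VU (coim_to_im _ _)).
exact: (@limP _ _ _ y (basic_self U)
  (basics_in_widen (VU : rincl (basic_to_open U) (basic_to_open V)) (basic_self V)) VU).
Qed.

End ImageCoimage.

Theorem proposition5p6 (R : realType) (X : stratSpace R) (I : bisheaf R X)
    (hI : is_isobisheaf I) :
  is_colocal_system (im_cosheaf hI) /\
  exists hcoim : is_local_system (coim_sheaf hI),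
    equivalent (im_cosheaf hI) hcoim.
Proof.
split; first exact: im_cosheaf_colocal.
exists (coim_sheaf_local hI).
(* Both cosheaves are generated from basic opens, so an isomorphism of the generating functors
   suffices. *)
exact/gen_cosheaf_iso/functor_iso_sym/inverse_coim_iso.
Qed.
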